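(* There is a one-to-one correspondence between $H^1_d(r_{DJ},F,d)$ and gauge equivalence classes of quadratic DJ-Lie bialgebra structures on $\mathfrak g=\mathfrak{su}(n,F,d)$.
   Context: $F$ is a field of characteristic zero, $d\in F^*\setminus {F^*}^2$, $K=F(\sqrt d)$, $\overline F$ an algebraic closure of $F$ containing $K$, $n$ a positive integer. For a matrix $A$ over $K$, $\overline A$ is obtained by applying the nontrivial element of $\mathrm{Gal}(K/F)$ to the entries, and $A^*=\overline A^T$. $\mathrm U(n,d)(F)=\{X\in\mathrm{GL}(n,K):X^*X=1\}$ and $\mathfrak{su}(n,F,d)=\{A\in\mathfrak{sl}(n,K):A^*+A=0\}$; the scalar extension of the latter to $\overline F$ is $\mathfrak{sl}(n,\overline F)$. $\mathrm{Ad}_X(A)=XAX^{-1}$. For $s\in\mathfrak a\otimes\mathfrak a$, $\partial s$ is the map $a\mapsto[s,a\otimes1+1\otimes a]$. The Drinfeld--Jimbo $r$-matrix is $r_{DJ}=\frac12\Omega_0+\sum_{i<j}E_{ij}\otimes E_{ji}$, where $\Omega_0=\sum_i h_i\otimes h_i$ for an orthonormal basis $(h_i)$ of the diagonal Cartan subalgebra with respect to the trace form. A quadratic DJ-Lie bialgebra structure on $\mathfrak g$ is (with the scalar normalized) a Lie bialgebra structure $\delta$ on $\mathfrak g$ such that $\delta_{\overline F}=\partial\big(\sqrt d(\mathrm{Ad}_X\otimes\mathrm{Ad}_X)(r_{DJ})\big)$ for some $X\in\mathrm{GL}(n,\overline F)$. Two Lie bialgebra structures $\delta_1,\delta_2$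 on $\mathfrak g$ are gauge equivalent if there is $Q\in\mathrm U(n,d)(F)$ with $\delta_2=(\mathrm{Ad}_Q\otimes\mathrm{Ad}_Q)\circ\delta_1\circ\mathrm{Ad}_Q^{-1}$. A diagonal type Belavin--Drinfeld cocycle is a matrix $X\in\mathrm{GL}(n,K)$ such that $X^*X=D_X$ for some diagonal $D_X\in\mathrm{GL}(n,F)$. Two cocycles $X,Y$ are cohomologous if $Y=QXD$ for some $Q\in\mathrm U(n,d)(F)$ and some diagonal $D\in\mathrm{GL}(n,K)$. $H^1_d(r_{DJ},F,d)$ is the set of cohomology classes of cocycles. *)

(* Defs.v *)
From HB Require Import structures.
From mathcomp Require Import all_boot all_order all_fingroup all_algebra all_field.
From mathcomp Require Import mxtens.
From mathcomp Require Import boolp classical_sets functions.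

Set Implicit Arguments.
Unset Strict Implicit.
Unset Printing Implicit Defensive.

Import GRing.Theory.
Local Open Scope ring_scope.

(* M_n(R) (x)_R M_n(R) is realized as the matrix algebra M_(n * n)(R): the     *)
(* pure tensor A (x) B is the Kronecker product A *t B. Similarly, the third   *)
(* tensor power is M_(n * n * n)(R), with pure tensors A *t B *t C.            *)
Notation "A *t B" := (tensmx A B)
  (at level 40, left associativity, format "A  *t  B") : ring_scope.

Section Tensors.
Variables (R : comUnitRingType) (n : nat).
Implicit Types (A B X : 'M[R]_n) (r s : 'M[R]_(n * n)).

Definition lieb m (A B : 'M[R]_m) : 'M[R]_m := A *m B - B *m A.

Definition Ad X A : 'M[R]_n := X *m A *m invmx X.

(* a (x) 1 + 1 (x) a *)
Definition diag_act A : 'M[R]_(n * n) := A *t 1%:M + 1%:M *t A.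

(* The bracket of g (x) g with a (x) 1 + 1 (x) a is the commutator in the      *)
(* associative algebra M_n (x) M_n: see lieb_diag_act.                         *)
Definition coboundary s A : 'M[R]_(n * n) := lieb s (diag_act A).

(* Ad_X (x) Ad_X is conjugation by X (x) X: see Ad2_tens.                      *)
Definition Ad2 X s : 'M[R]_(n * n) := (X *t X) *m s *m (invmx X *t invmx X).

Lemma lieb_diag_act A B C :
  lieb (A *t B) (diag_act C) = lieb A C *t B + A *t lieb B C.
Proof.
rewrite /lieb /diag_act mulmxDr mulmxDl !tensmx_mul !mulmx1 !mul1mx.
apply/matrixP=> i j; rewrite !mxE mulrBl mulrBr.
by rewrite opprD addrACA.
Qed.

Lemma Ad2_tens X A B : Ad2 X (A *t B) = Ad X A *t Ad X B.
Proof. by rewrite /Ad2 /Ad !tensmx_mul. Qed.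

(* h is an orthonormal basis, for the trace form (A, B) |-> \tr (A *m B), of   *)
(* the Cartan subalgebra of traceless diagonal matrices.                       *)
Definition orthonormal_cartan_basis (h : 'I_n.-1 -> 'M[R]_n) : Prop :=
  [/\ forall i, is_diag_mx (h i) /\ \tr (h i) = 0,
      forall i j, \tr (h i *m h j) = (i == j)%:R &
      forall H : 'M[R]_n, is_diag_mx H -> \tr H = 0 ->
        exists c : 'I_n.-1 -> R, H = \sum_i c i *: h i].

Definition r_DJ (h : 'I_n.-1 -> 'M[R]_n) : 'M[R]_(n * n) :=
  2%:R^-1 *: (\sum_i h i *t h i)
  + \sum_(i < n) \sum_(j < n | (i < j)%N) delta_mx i j *t delta_mx j i.

End Tensors.

Section Unitary.
(* An element of gal_of {:K} is an automorphism of K over the base field F.    *)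
Variables (F : fieldType) (K : splittingFieldType F) (sigma : gal_of {:K}).
Variable n : nat.
Implicit Types (A B Q : 'M[K]_n).

Definition adjmx (A : 'M[K]_n) : 'M[K]_n := (map_mx sigma A)^T.

Definition unitary (Q : 'M[K]_n) : Prop :=
  Q \in unitmx /\ adjmx Q *m Q = 1%:M.

Definition su_pred : {pred 'M[K]_n} :=
  [pred A | (\tr A == 0) && (adjmx A + A == 0)].

Record su : Type := Su { su_val :> 'M[K]_n; su_valP : su_val \in su_pred }.

HB.instance Definition _ := [isSub for su_val].
HB.instance Definition _ := [Choice of su by <:].

Lemma adjmx_is_additive A B : adjmx (A - B) = adjmx A - adjmx B.
Proof. by apply/matrixP=> i j; rewrite !mxE rmorphB. Qed.

Lemma adjmxM A B : adjmx (A *m B) = adjmx B *m adjmx A.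
Proof. by rewrite /adjmx map_mxM trmx_mul. Qed.

Lemma adjmxZ (a : F) A : adjmx (a%:A *: A) = a%:A *: adjmx A.
Proof.
apply/matrixP=> i j; rewrite !mxE rmorphM /=; congr (_ * _).
exact: rmorph_alg.
Qed.

Lemma suP A : reflect (\tr A = 0 /\ adjmx A = - A) (A \in su_pred).
Proof.
rewrite inE addr_eq0; apply: (iffP andP) => -[].
- by move=> /eqP tA /eqP sA.
- by move=> -> ->.
Qed.

Fact su_zmod_closed : zmod_closed su_pred.
Proof.
split=> [|A B /suP[tA sA] /suP[tB sB]]; apply/suP; split.
- exact: mxtrace0.
- by apply/matrixP=> i j; rewrite !mxE rmorph0 oppr0.
- by rewrite raddfB /= tA tB subr0.
- by rewrite adjmx_is_additive sA sB opprB opprK addrC.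
Qed.

HB.instance Definition _ := GRing.isZmodClosed.Build _ su_pred su_zmod_closed.
HB.instance Definition _ := [SubChoice_isSubZmodule of su by <:].

Fact su_scale_subproof (a : F) (A : su) : a%:A *: val A \in su_pred.
Proof.
have /suP[tA sA] := su_valP A; apply/suP; split.
- by rewrite mxtraceZ tA mulr0.
- by rewrite adjmxZ sA scalerN.
Qed.

Definition su_scale (a : F) (A : su) : su := Su (su_scale_subproof a A).

Fact su_scaleA a b (A : su) : su_scale a (su_scale b A) = su_scale (a * b) A.
Proof. by apply: val_inj; rewrite /= scalerA -scalerAl mul1r scalerA. Qed.
Fact su_scale1 : left_id 1 su_scale.
Proof. by move=> A; apply: val_inj; rewrite /= !scale1r. Qed.
Fact su_scaleDr : right_distributive su_scale +%R.
Proof. by move=> a A B; apply: val_inj; exact: scalerDr. Qed.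
Fact su_scaleDl (A : su) : {morph su_scale^~ A : a b / a + b}.
Proof. by move=> a b; apply: val_inj; rewrite /= scalerDl scalerDl.
Qed.

HB.instance Definition _ := GRing.Zmodule_isLmodule.Build F su
  su_scaleA su_scale1 su_scaleDr su_scaleDl.

Fact su_lieb_subproof (A B : su) : lieb (val A) (val B) \in su_pred.
Proof.
have /suP[_ sA] := su_valP A; have /suP[_ sB] := su_valP B.
apply/suP; split; rewrite /lieb.
- by rewrite raddfB /= mxtrace_mulC subrr.
- by rewrite adjmx_is_additive !adjmxM sA sB !mulNmx !mulmxN !opprK opprB.
Qed.

Definition su_lieb (A B : su) : su := Su (su_lieb_subproof A B).

Fact su_Ad_inv_subproof Q (uQ : unitary Q) (A : su) :
  Ad (invmx Q) (val A) \in su_pred.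
Proof.
have /suP[tA sA] := su_valP A; case: uQ => uQ QQ; apply/suP.
have Qi : invmx Q = adjmx Q.
  by rewrite -[RHS]mulmx1 -(mulmxV uQ) mulmxA QQ mul1mx.
have Qa : adjmx (invmx Q) = Q.
  by rewrite -[LHS]mulmx1 -QQ mulmxA -adjmxM mulmxV // /adjmx map_mx1 trmx1 mul1mx.
rewrite /Ad invmxK; split; first by rewrite mxtrace_mulC mulmxA mulmxV ?mul1mx.
by rewrite !adjmxM sA Qa -Qi mulNmx mulmxN mulmxA.
Qed.

Definition su_Ad_inv Q (uQ : unitary Q) (A : su) : su :=
  Su (su_Ad_inv_subproof uQ A).

(* su (x)_F su, inside M_n(K) (x)_K M_n(K): an F-basis of su is a K-basis of   *)
(* sl(n, K), so that the canonical map between these spaces is injective.      *)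
Definition su_tens2 (t : 'M[K]_(n * n)) : Prop :=
  exists m (A B : 'I_m -> su), t = \sum_i val (A i) *t val (B i).

(* The images of delta under the flip and the sum over cyclic permutations of  *)
(* (delta (x) id) \o delta are computed from arbitrary decompositions of       *)
(* delta a (and of the delta (A i)) into pure tensors of elements of su.       *)
Record lie_bialgebra (delta : su -> 'M[K]_(n * n)) : Prop := LieBialgebra {
  cobr_tens : forall a, su_tens2 (delta a);
  cobr_linear : forall (c : F) a b,
    delta (c *: a + b) = c%:A *: delta a + delta b;
  cobr_skew : forall a m (A B : 'I_m -> su),
    delta a = \sum_i val (A i) *t val (B i) ->
    \sum_i val (B i) *t val (A i) = - delta a;
  cobr_coJacobi : forall a m (A B : 'I_m -> su) p (C D : 'I_m -> 'I_p -> su),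
    delta a = \sum_i val (A i) *t val (B i) ->
    (forall i, delta (A i) = \sum_j val (C i j) *t val (D i j)) ->
    \sum_i \sum_j (val (C i j) *t val (D i j) *t val (B i)
                   + val (D i j) *t val (B i) *t val (C i j)
                   + val (B i) *t val (C i j) *t val (D i j)) = 0;
  cobr_cocycle : forall a b,
    delta (su_lieb a b) = lieb (diag_act (val a)) (delta b)
                          - lieb (diag_act (val b)) (delta a)
}.

Definition gauge_equiv (delta1 delta2 : su -> 'M[K]_(n * n)) : Prop :=
  exists Q (uQ : unitary Q), delta2 = Ad2 Q \o delta1 \o su_Ad_inv uQ.

Definition DJ_cocycle (X : 'M[K]_n) : Prop :=
  X \in unitmx /\
  exists D : 'M[F]_n, [/\ is_diag_mx D, D \in unitmx &
                          adjmx X *m X = map_mx (in_alg K) D].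

Definition cohomologous (X Y : 'M[K]_n) : Prop :=
  exists Q D : 'M[K]_n,
    [/\ unitary Q, is_diag_mx D, D \in unitmx & Y = Q *m X *m D].

Section ScalarExtension.
Variables (L : fieldType) (iota : {rmorphism K -> L}).

(* delta_L is the L-linear extension of delta to L (x)_F su = sl(n, L); only   *)
(* the values of delta_L on sl(n, L) matter.                                   *)
Definition scalar_extension (delta : su -> 'M[K]_(n * n))
    (delta_L : 'M[L]_n -> 'M[L]_(n * n)) : Prop :=
  (forall (c : L) (A B : 'M[L]_n), \tr A = 0 -> \tr B = 0 ->
     delta_L (c *: A + B) = c *: delta_L A + delta_L B) /\
  (forall a : su, delta_L (map_mx iota (val a)) = map_mx iota (delta a)).

Variables (sqrtd : K) (h : 'I_n.-1 -> 'M[L]_n).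

Definition DJ_given_by (delta : su -> 'M[K]_(n * n)) (X : 'M[L]_n) : Prop :=
  scalar_extension delta (coboundary (iota sqrtd *: Ad2 X (r_DJ h))).

Definition quadratic_DJ (delta : su -> 'M[K]_(n * n)) : Prop :=
  lie_bialgebra delta /\ exists X : 'M[L]_n, X \in unitmx /\ DJ_given_by delta X.

End ScalarExtension.

End Unitary.

Local Open Scope classical_set_scope.

Definition eq_class T (P : set T) (R : T -> T -> Prop) (x : T) : set T :=
  [set y | P y /\ R x y].

Definition eq_classes T (P : set T) (R : T -> T -> Prop) : set (set T) :=
  [set eq_class P R x | x in P].

Section Classes.
Variables (F : fieldType) (K : splittingFieldType F) (sigma : gal_of {:K}).
Variable n : nat.

Definition H1_class (X : 'M[K]_n) : set 'M[K]_n :=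
  eq_class (DJ_cocycle sigma (n := n)) (cohomologous sigma (n := n)) X.

Definition H1_DJ : set (set 'M[K]_n) :=
  eq_classes (DJ_cocycle sigma (n := n)) (cohomologous sigma (n := n)).

Definition quadratic_DJ_classes (L : fieldType) (iota : {rmorphism K -> L})
    (sqrtd : K) (h : 'I_n.-1 -> 'M[L]_n) : set (set (su sigma n -> 'M[K]_(n * n))) :=
  eq_classes (quadratic_DJ iota sqrtd h) (gauge_equiv (sigma := sigma) (n := n)).

End Classes.

Arguments H1_class {F K} sigma {n} X _ : rename.
Arguments H1_DJ {F K} sigma n _ : rename.
Arguments quadratic_DJ_classes {F K} sigma {n L} iota sqrtd h _ : rename.

(* Main.v *)
(* Let r be the Drinfeld-Jimbo matrix and delta_X the coboundary of
   sqrt d (Ad_X (x) Ad_X)(r). The multiplication A (x) B |-> AB sends the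
   coboundary of s to the inner derivation ad m(s), and m(r) is, up to a scalar,
   a diagonal matrix T with distinct rational entries. So delta_X determines
   X T X^-1. This has three consequences.
   - delta_X = delta_Y forces X^-1 Y to commute with T, hence to be diagonal, and
     diagonal matrices stabilize r. As gauge transformation by Q turns delta_X
     into delta_QX, gauge equivalence of delta_X and delta_Y means that X and Y
     are cohomologous.
   - If delta_X, with X over the algebraic closure, comes from su, then X T X^-1
     is defined over K, since n M - tr M is the sum of the [M, E_ij] E_ji. Its
     eigenvalues are rational, so eigenvectors over K give Y in GL(n, K) with
     X^-1 Y diagonal, and delta = delta_Y.
   - Skew-symmetry and the su-valuedness of delta_Y make Y T Y^-1 self-adjoint,
     so Y^* Y commutes with T: it is diagonal, with Galois-invariant entries.
   Conversely delta_X is a Lie bialgebra structure for a cocycle X: r plus its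
   flip is the flip operator, r satisfies the classical Yang-Baxter equation, and
   X^* X = D makes delta_X(a) a self-adjoint tensor of traceless matrices. *)

Require Import Defs.
From mathcomp Require Import all_boot all_order all_fingroup all_algebra all_field.
From mathcomp Require Import boolp classical_sets functions.
From mathcomp Require Import mxtens ring.

Set Implicit Arguments.
Unset Strict Implicit.
Unset Printing Implicit Defensive.

Import GRing.Theory.

Local Open Scope ring_scope.

(** * Tensor squares of matrix algebras *)

Section TensorAlgebra.
Variables (R : comUnitRingType) (n : nat).
Implicit Types (A B C D X Y : 'M[R]_n) (s t : 'M[R]_(n * n)).

Lemma tensmxDl m p q r (A A' : 'M[R]_(m, p)) (B : 'M[R]_(q, r)) :
  (A + A') *t B = A *t B + A' *t B.
Proof. by apply/matrixP=> i j; rewrite !mxE mulrDl. Qed.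

Lemma tensmxDr m p q r (A : 'M[R]_(m, p)) (B B' : 'M[R]_(q, r)) :
  A *t (B + B') = A *t B + A *t B'.
Proof. by apply/matrixP=> i j; rewrite !mxE mulrDr. Qed.

Lemma tensmxZl m p q r a (A : 'M[R]_(m, p)) (B : 'M[R]_(q, r)) :
  (a *: A) *t B = a *: (A *t B).
Proof. by apply/matrixP=> i j; rewrite !mxE mulrA. Qed.

Lemma tensmxZr m p q r a (A : 'M[R]_(m, p)) (B : 'M[R]_(q, r)) :
  A *t (a *: B) = a *: (A *t B).
Proof. by apply/matrixP=> i j; rewrite !mxE mulrCA. Qed.

Lemma tensmxNl m p q r (A : 'M[R]_(m, p)) (B : 'M[R]_(q, r)) :
  (- A) *t B = - (A *t B).
Proof. by rewrite -!scaleN1r tensmxZl. Qed.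

Lemma tensmxNr m p q r (A : 'M[R]_(m, p)) (B : 'M[R]_(q, r)) :
  A *t (- B) = - (A *t B).
Proof. by rewrite -!scaleN1r tensmxZr. Qed.

Lemma tensmx_suml m p q r I e P (A : I -> 'M[R]_(m, p)) (B : 'M[R]_(q, r)) :
  (\sum_(i <- e | P i) A i) *t B = \sum_(i <- e | P i) A i *t B.
Proof.
apply/matrixP=> i j; rewrite mxE !summxE mulr_suml.
by apply: eq_bigr => k _; rewrite mxE.
Qed.

Lemma tensmx_sumr m p q r I e P (A : 'M[R]_(m, p)) (B : I -> 'M[R]_(q, r)) :
  A *t (\sum_(i <- e | P i) B i) = \sum_(i <- e | P i) A *t B i.
Proof.
apply/matrixP=> i j; rewrite mxE !summxE mulr_sumr.
by apply: eq_bigr => k _; rewrite mxE.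
Qed.

(** For [P] of square 1 this is conjugation by [P], written without an inverse. It is used for
    permutations of tensor factors. *)
Definition involution_conj m (P M : 'M[R]_m) := P *m M *m P.

Lemma involution_conjD m (P : 'M[R]_m) :
  {morph involution_conj P : M N / M + N}.
Proof. by move=> M N; rewrite /involution_conj mulmxDr mulmxDl. Qed.

Lemma involution_conjZ m (P : 'M[R]_m) a M :
  involution_conj P (a *: M) = a *: involution_conj P M.
Proof. by rewrite /involution_conj -scalemxAr -scalemxAl. Qed.

Lemma involution_conjN m (P : 'M[R]_m) M :
  involution_conj P (- M) = - involution_conj P M.
Proof. by rewrite -!scaleN1r involution_conjZ. Qed.

Lemma involution_conjB m (P : 'M[R]_m) :
  {morph involution_conj P : M N / M - N}.
Proof. by move=> M N; rewrite involution_conjD involution_conjN. Qed.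

Lemma involution_conj_sum m (P : 'M[R]_m) I e Q (f : I -> 'M[R]_m) :
  involution_conj P (\sum_(i <- e | Q i) f i) =
  \sum_(i <- e | Q i) involution_conj P (f i).
Proof. by rewrite /involution_conj mulmx_sumr mulmx_suml. Qed.

Lemma involution_conjK m (P : 'M[R]_m) : P *m P = 1%:M ->
  involutive (involution_conj P).
Proof.
by move=> PP M; rewrite /involution_conj !mulmxA PP mul1mx -mulmxA PP mulmx1.
Qed.

Lemma involution_conj_mul m (P M N : 'M[R]_m) : P *m P = 1%:M ->
  involution_conj P (M *m N) = involution_conj P M *m involution_conj P N.
Proof.
by move=> PP; rewrite /involution_conj !mulmxA -[_ *m P *m P]mulmxA PP mulmx1.
Qed.

Lemma involution_conj_id m (P M : 'M[R]_m) : P *m P = 1%:M ->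
  P *m M = M *m P -> involution_conj P M = M.
Proof. by move=> PP PM; rewrite /involution_conj PM -mulmxA PP mulmx1. Qed.

Lemma involution_conj_lieb m (P M N : 'M[R]_m) : P *m P = 1%:M ->
  involution_conj P (lieb M N) =
  lieb (involution_conj P M) (involution_conj P N).
Proof.
by move=> PP; rewrite /lieb involution_conjB !involution_conj_mul.
Qed.

Lemma tens11 m p : 1%:M *t 1%:M = 1%:M :> 'M[R]_(m * p).
Proof.
apply/matrixP=> a b.
case: (mxtens_indexP a) => i k; case: (mxtens_indexP b) => j l.
by rewrite tensmxE !mxE (can_eq (@mxtens_indexK _ _)) xpair_eqE -natrM mulnb.
Qed.

Lemma tens_delta m p q r (i : 'I_m) (j : 'I_p) (k : 'I_q) (l : 'I_r) :
  delta_mx i j *t delta_mx k l =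
  delta_mx (mxtens_index (i, k)) (mxtens_index (j, l)) :> 'M[R]_(m * q, p * r).
Proof.
apply/matrixP=> a b.
case: (mxtens_indexP a) => a1 a2; case: (mxtens_indexP b) => b1 b2.
rewrite tensmxE !mxE !(can_eq (@mxtens_indexK _ _)) /= !xpair_eqE.
by rewrite -natrM mulnb andbACA.
Qed.

Definition bvec p (i : 'I_p) : 'cV[R]_p := delta_mx i 0.

Lemma tens_delta_col p q (i : 'I_p) (k : 'I_q) :
  bvec i *t bvec k =
  bvec (mxtens_index (i, k)) :> 'cV[R]_(p * q).
Proof. by rewrite tens_delta; congr delta_mx; apply: ord1. Qed.

Lemma eq_mx_on_basis m p (M N : 'M[R]_(m, p)) :
  (forall k, M *m bvec k = N *m bvec k) -> M = N.
Proof.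
move=> MN; apply/matrixP=> i j; have := MN j; rewrite -!colE.
by move=> /matrixP/(_ i 0); rewrite !mxE.
Qed.

Lemma eq_mx_on_basis2 m p q (M N : 'M[R]_(m, p * q)) :
  (forall i j, M *m (bvec i *t bvec j) =
               N *m (bvec i *t bvec j)) -> M = N.
Proof.
move=> MN; apply: eq_mx_on_basis => k; case: (mxtens_indexP k) => i j.
by rewrite -tens_delta_col; apply: MN.
Qed.

Lemma eq_mx_on_basis3 m p q r (M N : 'M[R]_(m, p * q * r)) :
  (forall i j k,
     M *m (bvec i *t bvec j *t bvec k) =
     N *m (bvec i *t bvec j *t bvec k)) -> M = N.
Proof.
move=> MN; apply: eq_mx_on_basis2 => x k; case: (mxtens_indexP x) => i j.
by rewrite -tens_delta_col; apply: MN.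
Qed.

(** Matrix units of the big matrix algebra are Kronecker products of matrix units. Scalars are
    absorbed into the first factor, so closure under addition is enough. *)
Lemma tens_ind (P : 'M[R]_(n * n) -> Prop) :
  P 0 -> (forall s t, P s -> P t -> P (s + t)) -> (forall A B, P (A *t B)) ->
  forall t, P t.
Proof.
move=> P0 PD PT t; rewrite [t]matrix_sum_delta.
elim/big_ind: _ => // a _; elim/big_ind: _ => // b _.
case: (mxtens_indexP a) => a1 a2; case: (mxtens_indexP b) => b1 b2.
by rewrite -tens_delta -tensmxZl; apply: PT.
Qed.

Lemma eq_on_tens (V : zmodType) (f g : 'M[R]_(n * n) -> V) :
  {morph f : s t / s + t} -> {morph g : s t / s + t} ->
  (forall A B, f (A *t B) = g (A *t B)) -> f =1 g.
Proof.
move=> fD gD fg; apply: tens_ind => // [|s t fs ft]; last by rewrite fD gD fs ft.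
have z (k : 'M[R]_(n * n) -> V) : {morph k : s t / s + t} -> k 0 = 0.
  by move=> kD; have /esym/eqP := kD 0 0; rewrite addr0 -subr_eq0 addrK => /eqP.
by rewrite (z _ fD) (z _ gD).
Qed.

(** The permutation matrix exchanging the factors of v (x) w, which is also the Casimir tensor of
    gl(n). Conjugation by it exchanges the factors of A (x) B. *)
Definition flip : 'M[R]_(n * n) := \sum_i \sum_j delta_mx i j *t delta_mx j i.

Lemma delta_mulmx_col (v : 'cV[R]_n) (i j : 'I_n) :
  delta_mx i j *m v = v j 0 *: delta_mx i 0.
Proof.
apply/matrixP=> k l; rewrite !mxE (bigD1 j) //= !mxE eqxx andbT big1 ?addr0.
  by rewrite !ord1 eqxx andbT mulrC.
by move=> m /negPf jm; rewrite mxE jm andbF mul0r.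
Qed.

Lemma flip_col (v w : 'cV[R]_n) : flip *m (v *t w) = w *t v.
Proof.
rewrite mulmx_suml [in RHS](matrix_sum_delta w) tensmx_suml.
apply: eq_bigr => i _; rewrite mulmx_suml big_ord1 [in RHS](matrix_sum_delta v).
rewrite tensmx_sumr; apply: eq_bigr => j _; rewrite big_ord1.
by rewrite tensmx_mul !delta_mulmx_col !tensmxZl !tensmxZr !scalerA mulrC.
Qed.

Lemma flip_tens A B : flip *m (A *t B) = (B *t A) *m flip.
Proof.
by apply: eq_mx_on_basis2 => i j; rewrite -!mulmxA flip_col !tensmx_mul flip_col.
Qed.

Lemma flipK : flip *m flip = 1%:M.
Proof. by apply: eq_mx_on_basis2 => i j; rewrite -mulmxA !flip_col mul1mx. Qed.

Lemma flip_diag_act A : flip *m diag_act A = diag_act A *m flip.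
Proof. by rewrite /diag_act mulmxDr mulmxDl !flip_tens addrC. Qed.

Lemma flip_conj_tens A B : involution_conj flip (A *t B) = B *t A.
Proof. by rewrite /involution_conj flip_tens -mulmxA flipK mulmx1. Qed.

(** The linear map A (x) B |-> AB, given on entries so that no decomposition into pure tensors has
    to be chosen. *)
Definition mulmap s : 'M[R]_n :=
  \matrix_(i, j) \sum_k s (mxtens_index (i, k)) (mxtens_index (k, j)).

Lemma mulmap_tens A B : mulmap (A *t B) = A *m B.
Proof.
apply/matrixP=> i j; rewrite !mxE; apply: eq_bigr => k _.
by rewrite tensmxE.
Qed.

Lemma mulmapD : {morph mulmap : s t / s + t}.
Proof.
move=> s t; apply/matrixP=> i j; rewrite !mxE -big_split.
by apply: eq_bigr => k _; rewrite mxE.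
Qed.

Lemma mulmapZ a s : mulmap (a *: s) = a *: mulmap s.
Proof.
by apply/matrixP=> i j; rewrite !mxE mulr_sumr; apply: eq_bigr => k _; rewrite mxE.
Qed.

Lemma mulmap0 : mulmap 0 = 0.
Proof. by rewrite -[0](scale0r (0 : 'M_(n * n))) mulmapZ scale0r. Qed.

Lemma mulmapN s : mulmap (- s) = - mulmap s.
Proof. by rewrite -!scaleN1r mulmapZ. Qed.

Lemma mulmap_sum I e P (f : I -> 'M[R]_(n * n)) :
  mulmap (\sum_(i <- e | P i) f i) = \sum_(i <- e | P i) mulmap (f i).
Proof. by apply: big_morph; [exact: mulmapD | exact: mulmap0]. Qed.

(** * Commutators, coboundaries and the adjoint action *)

Lemma liebDl m (A B C : 'M[R]_m) : lieb (A + B) C = lieb A C + lieb B C.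
Proof. by rewrite /lieb mulmxDr mulmxDl opprD addrACA. Qed.

Lemma liebC m (A B : 'M[R]_m) : lieb A B = - lieb B A.
Proof. by rewrite /lieb opprB. Qed.

Lemma liebDr m (A B C : 'M[R]_m) : lieb A (B + C) = lieb A B + lieb A C.
Proof. by rewrite liebC liebDl opprD -!liebC. Qed.

Lemma liebZl m a (A B : 'M[R]_m) : lieb (a *: A) B = a *: lieb A B.
Proof. by rewrite /lieb -scalemxAl -scalemxAr scalerBr. Qed.

Lemma liebZr m a (A B : 'M[R]_m) : lieb A (a *: B) = a *: lieb A B.
Proof. by rewrite liebC liebZl -scalerN -liebC. Qed.

Lemma liebNl m (A B : 'M[R]_m) : lieb (- A) B = - lieb A B.
Proof. by rewrite -!scaleN1r liebZl. Qed.

Lemma liebNr m (A B : 'M[R]_m) : lieb A (- B) = - lieb A B.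
Proof. by rewrite -!scaleN1r liebZr. Qed.

Lemma lieb0l m (A : 'M[R]_m) : lieb 0 A = 0.
Proof. by rewrite /lieb mul0mx mulmx0 subrr. Qed.

Lemma liebsl m (c : R) (A : 'M[R]_m) : lieb c%:M A = 0.
Proof. by rewrite /lieb scalar_mxC subrr. Qed.

Lemma lieb_jacobi m (A B C : 'M[R]_m) :
  lieb (lieb A B) C = lieb A (lieb B C) - lieb B (lieb A C).
Proof.
rewrite /lieb !(mulmxBl, mulmxBr) !mulmxA; apply/matrixP=> i j.
have E (M N : 'M[R]_m) : (M - N) i j = M i j - N i j by rewrite !mxE.
by rewrite !E; ring.
Qed.

(* Multiplication [M_n (x) M_n -> M_n] turns the coboundary of [s] into the
   inner derivation given by the image of [s]. *)
Lemma mulmap_coboundary s A :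
  mulmap (coboundary s A) = lieb (mulmap s) A.
Proof.
move: s; apply: eq_on_tens => [s t|s t|B C].
- by rewrite /coboundary liebDl mulmapD.
- by rewrite mulmapD liebDl.
rewrite /coboundary lieb_diag_act mulmapD !mulmap_tens /lieb.
by rewrite mulmxBl mulmxBr !mulmxA addrC addrA subrK.
Qed.

Lemma mulmap_Ad2 X s : X \in unitmx -> mulmap (Ad2 X s) = Ad X (mulmap s).
Proof.
move=> uX; move: s; apply: eq_on_tens => [s t|s t|B C].
- by rewrite /Ad2 mulmxDr mulmxDl mulmapD.
- by rewrite mulmapD /Ad mulmxDr mulmxDl.
by rewrite Ad2_tens !mulmap_tens /Ad !mulmxA mulmxKV.
Qed.

Lemma diag_actD A B : diag_act (A + B) = diag_act A + diag_act B.
Proof. by rewrite /diag_act tensmxDl tensmxDr addrACA. Qed.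

Lemma diag_actZ a A : diag_act (a *: A) = a *: diag_act A.
Proof. by rewrite /diag_act tensmxZl tensmxZr scalerDr. Qed.

Lemma diag_actN A : diag_act (- A) = - diag_act A.
Proof. by rewrite -!scaleN1r diag_actZ. Qed.

Lemma diag_act_lieb A B : diag_act (lieb A B) = lieb (diag_act A) (diag_act B).
Proof.
rewrite [diag_act A]/(_ + _) liebDl !lieb_diag_act /diag_act.
by rewrite !liebsl tens0mx tensmx0 add0r addr0.
Qed.

Lemma coboundaryD s t A : coboundary (s + t) A = coboundary s A + coboundary t A.
Proof. exact: liebDl. Qed.

Lemma coboundaryZ a s A : coboundary (a *: s) A = a *: coboundary s A.
Proof. exact: liebZl. Qed.

Lemma coboundary_linear s a A B :
  coboundary s (a *: A + B) = a *: coboundary s A + coboundary s B.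
Proof. by rewrite /coboundary diag_actD diag_actZ liebDr liebZr. Qed.

(** Coboundaries are cocycles: the Jacobi identity for [s] and two elements in the image of the Lie
    morphism [diag_act]. *)
Lemma coboundary_lieb s A B :
  coboundary s (lieb A B) =
  lieb (diag_act A) (coboundary s B) - lieb (diag_act B) (coboundary s A).
Proof.
rewrite /coboundary diag_act_lieb liebC lieb_jacobi.
by rewrite ![lieb _ s]liebC !liebNr opprD !opprK addrC.
Qed.

Lemma Ad2D X s t : Ad2 X (s + t) = Ad2 X s + Ad2 X t.
Proof. by rewrite /Ad2 mulmxDr mulmxDl. Qed.

Lemma Ad2Z X a s : Ad2 X (a *: s) = a *: Ad2 X s.
Proof. by rewrite /Ad2 -scalemxAr -scalemxAl. Qed.

Lemma Ad2N X s : Ad2 X (- s) = - Ad2 X s.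
Proof. by rewrite -!scaleN1r Ad2Z. Qed.

Lemma invmxM X Y : X \in unitmx -> Y \in unitmx ->
  invmx (X *m Y) = invmx Y *m invmx X.
Proof.
move=> uX uY; have uXY : X *m Y \in unitmx by rewrite unitmx_mul uX.
have E : X *m Y *m (invmx Y *m invmx X) = 1%:M.
  by rewrite -mulmxA (mulKVmx uY) mulmxV.
by rewrite -[LHS]mulmx1 -E mulKmx.
Qed.

Lemma Ad2M X Y s : X \in unitmx -> Y \in unitmx ->
  Ad2 (X *m Y) s = Ad2 X (Ad2 Y s).
Proof. by move=> uX uY; rewrite /Ad2 invmxM // -!tensmx_mul !mulmxA. Qed.

Lemma tensmxV X : X \in unitmx -> (X *t X) *m (invmx X *t invmx X) = 1%:M.
Proof. by move=> uX; rewrite tensmx_mul mulmxV // tens11. Qed.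

Lemma tensVmx X : X \in unitmx -> (invmx X *t invmx X) *m (X *t X) = 1%:M.
Proof. by move=> uX; rewrite tensmx_mul mulVmx // tens11. Qed.

Lemma Ad2_lieb X s t : X \in unitmx -> Ad2 X (lieb s t) = lieb (Ad2 X s) (Ad2 X t).
Proof.
move=> uX; rewrite /lieb /Ad2 mulmxBr mulmxBl !mulmxA.
rewrite -[_ *m (invmx X *t invmx X) *m (X *t X)]mulmxA.
rewrite -[_ *m t *m (invmx X *t invmx X) *m (X *t X)]mulmxA.
by rewrite tensVmx // !mulmx1.
Qed.

Lemma Ad2_diag_act X A : X \in unitmx -> Ad2 X (diag_act A) = diag_act (Ad X A).
Proof.
by move=> uX; rewrite Ad2D !Ad2_tens /diag_act {2 3}/Ad mulmx1 mulmxV.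
Qed.

Lemma Ad2_coboundary X s A : X \in unitmx ->
  Ad2 X (coboundary s A) = coboundary (Ad2 X s) (Ad X A).
Proof. by move=> uX; rewrite Ad2_lieb // Ad2_diag_act. Qed.

Lemma Ad_invK X A : X \in unitmx -> Ad X (Ad (invmx X) A) = A.
Proof.
by move=> uX; rewrite /Ad invmxK !mulmxA mulmxV // mul1mx mulmxK.
Qed.

End TensorAlgebra.
Arguments flip {R n}.
(** * Co-Jacobi identity from the classical Yang-Baxter equation *)

Section TripleTensors.
Variables (R : comUnitRingType) (n : nat).
Implicit Types (A B C X : 'M[R]_n) (s t : 'M[R]_(n * n)) (M N : 'M[R]_(n * n * n)).

Definition flip12 : 'M[R]_(n * n * n) := flip *t 1%:M.

(** The size n * n * n associates to the left, so 1 (x) [flip] does not have the right type; hence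
    the expanded sum. *)
Definition flip23 : 'M[R]_(n * n * n) :=
  \sum_i \sum_j 1%:M *t delta_mx i j *t delta_mx j i.

Lemma flip12_col (u v w : 'cV[R]_n) : flip12 *m (u *t v *t w) = v *t u *t w.
Proof. by rewrite tensmx_mul flip_col mul1mx. Qed.

Lemma flip23_col (u v w : 'cV[R]_n) : flip23 *m (u *t v *t w) = u *t w *t v.
Proof.
rewrite mulmx_suml [in RHS](matrix_sum_delta w) tensmx_sumr tensmx_suml.
apply: eq_bigr => i _; rewrite mulmx_suml big_ord1 [in RHS](matrix_sum_delta v).
rewrite tensmx_sumr; apply: eq_bigr => j _; rewrite big_ord1.
rewrite !tensmx_mul mul1mx !delta_mulmx_col !(tensmxZl, tensmxZr) !scalerA.
by rewrite mulrC.
Qed.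

Lemma flip12K : flip12 *m flip12 = 1%:M.
Proof. by rewrite tensmx_mul flipK mul1mx tens11. Qed.

Lemma flip23K : flip23 *m flip23 = 1%:M.
Proof.
by apply: eq_mx_on_basis3 => i j k; rewrite -mulmxA !flip23_col mul1mx.
Qed.

(** Both sides exchange the first and third factors. *)
Lemma flip_braid :
  flip12 *m (flip23 *m flip12) = flip23 *m (flip12 *m flip23).
Proof.
by apply: eq_mx_on_basis3 => i j k; rewrite -!mulmxA !(flip12_col, flip23_col).
Qed.

Lemma flip12_tens A B C : flip12 *m (A *t B *t C) = (B *t A *t C) *m flip12.
Proof. by rewrite !tensmx_mul flip_tens mul1mx mulmx1. Qed.

Lemma flip23_tens A B C : flip23 *m (A *t B *t C) = (A *t C *t B) *m flip23.
Proof.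
apply: eq_mx_on_basis3 => i j k.
by rewrite -!mulmxA flip23_col !tensmx_mul flip23_col.
Qed.

Notation conj12 := (involution_conj flip12).
Notation conj23 := (involution_conj flip23).

Lemma conj12_tens A B C : conj12 (A *t B *t C) = B *t A *t C.
Proof. by rewrite /involution_conj flip12_tens -mulmxA flip12K mulmx1. Qed.

Lemma conj23_tens A B C : conj23 (A *t B *t C) = A *t C *t B.
Proof. by rewrite /involution_conj flip23_tens -mulmxA flip23K mulmx1. Qed.

(** The usual s_12, s_13 and s_23. The last two come from the first by permuting factors, so
    identities can be transported by conjugation. *)
Definition emb12 s : 'M[R]_(n * n * n) := s *t 1%:M.
Definition emb13 s := conj23 (emb12 s).
Definition emb23 s := conj12 (emb13 s).

Lemma emb12D : {morph emb12 : s t / s + t}.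
Proof. by move=> s t; apply: tensmxDl. Qed.
Lemma emb13D : {morph emb13 : s t / s + t}.
Proof. by move=> s t; rewrite /emb13 emb12D involution_conjD. Qed.
Lemma emb23D : {morph emb23 : s t / s + t}.
Proof. by move=> s t; rewrite /emb23 emb13D involution_conjD. Qed.

Lemma emb12Z a s : emb12 (a *: s) = a *: emb12 s.
Proof. exact: tensmxZl. Qed.
Lemma emb13Z a s : emb13 (a *: s) = a *: emb13 s.
Proof. by rewrite /emb13 emb12Z involution_conjZ. Qed.
Lemma emb23Z a s : emb23 (a *: s) = a *: emb23 s.
Proof. by rewrite /emb23 emb13Z involution_conjZ. Qed.

(** The left-hand side of the classical Yang-Baxter equation. *)
Definition cyb s : 'M[R]_(n * n * n) :=
  lieb (emb12 s) (emb13 s) + lieb (emb12 s) (emb23 s) + lieb (emb13 s) (emb23 s).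

Lemma cybZ a s : cyb (a *: s) = (a * a) *: cyb s.
Proof.
by rewrite /cyb emb12Z emb13Z emb23Z !liebZl !liebZr !scalerA !scalerDr.
Qed.

(** Conjugation by X (x) X (x) X is an algebra automorphism commuting with permutations of the
    factors, hence compatible with the three embeddings. *)
Lemma cyb_Ad2 X s : X \in unitmx -> cyb s = 0 -> cyb (Ad2 X s) = 0.
Proof.
move=> uX s0; pose Y := invmx X *t invmx X *t invmx X.
pose conjX M := X *t X *t X *m M *m Y.
have YX : Y *m (X *t X *t X) = 1%:M by rewrite !tensmx_mul mulVmx // !tens11.
have conjXM M N : conjX (M *m N) = conjX M *m conjX N.
  by rewrite /conjX !mulmxA -[_ *m Y *m _]mulmxA YX mulmx1.
have conjXB M N : conjX (M - N) = conjX M - conjX N.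
  by rewrite /conjX mulmxBr mulmxBl.
have conjXD M N : conjX (M + N) = conjX M + conjX N.
  by rewrite /conjX mulmxDr mulmxDl.
have conjXl M N : conjX (lieb M N) = lieb (conjX M) (conjX N).
  by rewrite /lieb conjXB !conjXM.
have e12 : emb12 (Ad2 X s) = conjX (emb12 s).
  by rewrite /emb12 /conjX /Y !tensmx_mul mulmx1 mulmxV.
have e13 : emb13 (Ad2 X s) = conjX (emb13 s).
  rewrite /emb13 e12 /conjX /involution_conj !mulmxA flip23_tens -!mulmxA.
  by rewrite flip23_tens.
have e23 : emb23 (Ad2 X s) = conjX (emb23 s).
  rewrite /emb23 e13 /conjX /involution_conj !mulmxA flip12_tens -!mulmxA.
  by rewrite flip12_tens.
by rewrite /cyb e12 e13 e23 -!conjXl -!conjXD -/(cyb s) s0 /conjX mulmx0 mul0mx.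
Qed.

Section CoJacobi.
Variables (s : 'M[R]_(n * n)) (kappa : R).
(** The symmetric part of [s] is a multiple of the invariant tensor [flip], so [s] behaves as a skew
    tensor inside coboundaries. *)
Hypothesis s_flip : s + involution_conj flip s = kappa *: flip.
Hypothesis s_cyb : cyb s = 0.

Let flip_s : involution_conj flip s = kappa *: flip - s.
Proof. by rewrite -s_flip addrAC subrr add0r. Qed.

Let conj12_s12 : conj12 (emb12 s) = kappa *: flip12 - emb12 s.
Proof.
rewrite /involution_conj !tensmx_mul !mulmx1 -/(involution_conj flip s) flip_s.
by rewrite tensmxDl tensmxZl tensmxNl.
Qed.

Let flip13 := conj23 flip12.

Let flip13E : conj12 flip23 = flip13.
Proof. by rewrite /flip13 /involution_conj -!mulmxA flip_braid. Qed.

Let conj_braid M : conj23 (conj12 (conj23 M)) = conj12 (conj23 (conj12 M)).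
Proof.
pose F := flip23 *m (flip12 *m flip23).
transitivity (F *m M *m F); first by rewrite /F /involution_conj !mulmxA.
by rewrite /F -flip_braid /involution_conj !mulmxA.
Qed.

(** The braid relation carries the skew-symmetry in the first two factors over to the last two. *)
Let conj23_s23 : conj23 (emb23 s) = kappa *: flip23 - emb23 s.
Proof.
rewrite /emb23 /emb13 conj_braid conj12_s12 !involution_conjB !involution_conjZ.
congr (_ *: _ - _); rewrite -/flip13 -flip13E involution_conjK //; exact: flip12K.
Qed.

Variable a : 'M[R]_n.

(** The action of [a] on the third tensor power. It is symmetric in the factors, so bracketing with
    it commutes with [conj12] and [conj23]. *)
Let Delta : 'M[R]_(n * n * n) := diag_act a *t 1%:M + 1%:M *t a.

Let DeltaE :
  Delta = a *t 1%:M *t 1%:M + 1%:M *t a *t 1%:M + 1%:M *t 1%:M *t a.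
Proof. by rewrite /Delta tensmxDl -tens11. Qed.

Let flip12_Delta : flip12 *m Delta = Delta *m flip12.
Proof.
rewrite DeltaE 2!mulmxDr 2!mulmxDl !flip12_tens; congr (_ + _); exact: addrC.
Qed.

Let flip23_Delta : flip23 *m Delta = Delta *m flip23.
Proof. by rewrite DeltaE 2!mulmxDr 2!mulmxDl !flip23_tens addrAC. Qed.

Let conj12l M : conj12 (lieb M Delta) = lieb (conj12 M) Delta.
Proof.
rewrite involution_conj_lieb; last exact: flip12K.
by rewrite (involution_conj_id flip12K flip12_Delta).
Qed.

Let conj23l M : conj23 (lieb M Delta) = lieb (conj23 M) Delta.
Proof.
rewrite involution_conj_lieb; last exact: flip23K.
by rewrite (involution_conj_id flip23K flip23_Delta).
Qed.

Let flip12l : lieb flip12 Delta = 0.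
Proof. by rewrite /lieb flip12_Delta subrr. Qed.

Let flip23l : lieb flip23 Delta = 0.
Proof. by rewrite /lieb flip23_Delta subrr. Qed.

Let emb12_cob : emb12 (coboundary s a) = lieb (emb12 s) Delta.
Proof.
rewrite /Delta liebDr /emb12 /lieb !tensmx_mul !mulmx1 !mul1mx subrr addr0.
by rewrite /coboundary /lieb tensmxDl tensmxNl.
Qed.

Let emb13_cob : emb13 (coboundary s a) = lieb (emb13 s) Delta.
Proof. by rewrite {1}/emb13 emb12_cob conj23l. Qed.

Let emb23_cob : emb23 (coboundary s a) = lieb (emb23 s) Delta.
Proof. by rewrite {1}/emb23 emb13_cob conj12l. Qed.

(* By the skew-symmetry of [s] up to [flip], the three cyclic terms add up to
   the adjoint action of [Delta] on the classical Yang-Baxter expression. *)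
Lemma cobracket_cyclic_sum :
  let S := lieb (emb12 s) (emb13 (coboundary s a) + emb23 (coboundary s a)) in
  S + conj23 (conj12 S) + conj12 (conj23 S) = 0.
Proof.
rewrite /= emb13_cob emb23_cob.
set s12 := emb12 s; set s13 := emb13 s; set s23 := emb23 s.
have c12_12 : conj12 s12 = kappa *: flip12 - s12 by exact: conj12_s12.
have c23_23 : conj23 s23 = kappa *: flip23 - s23 by exact: conj23_s23.
have c23_12 : conj23 s12 = s13 by [].
have c12_13 : conj12 s13 = s23 by [].
have c23_13 : conj23 s13 = s12 by rewrite -c23_12 involution_conjK //; exact: flip23K.
have c12_23 : conj12 s23 = s13 by rewrite -c12_13 involution_conjK //; exact: flip12K.
have lB M N : lieb (M - N) Delta = lieb M Delta - lieb N Delta.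
  by rewrite liebDl liebNl.
have l12 c M : lieb (c *: flip12 - M) Delta = - lieb M Delta.
  by rewrite lB liebZl flip12l scaler0 sub0r.
have l23 c M : lieb (c *: flip23 - M) Delta = - lieb M Delta.
  by rewrite lB liebZl flip23l scaler0 sub0r.
(* Exchanging the outer factors sends [s12] to [- s23] up to a multiple of [flip23], hence fixes
   [T]. So [T] commutes with [flip13], which removes the term in [kappa] below. *)
pose T := lieb s12 Delta - lieb s23 Delta.
have T13 : conj23 (conj12 (conj23 T)) = T.
  rewrite /T involution_conjB !conj23l c23_12 c23_23 l23 opprK.
  rewrite involution_conjD !conj12l c12_13 c12_23.
  by rewrite involution_conjD !conj23l c23_13 c23_23 l23 addrC.
have comm13 : lieb flip13 T = 0.
  have f13K : flip13 *m flip13 = 1%:M.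
    rewrite /flip13 -involution_conj_mul ?flip23K // flip12K /involution_conj.
    by rewrite mulmx1 flip23K.
  have T13' : flip13 *m T *m flip13 = T.
    by rewrite -[RHS]T13 /flip13 /involution_conj !mulmxA.
  by rewrite /lieb -{2}T13' -[X in _ - X]mulmxA f13K mulmx1 subrr.
rewrite !involution_conj_lieb ?flip12K ?flip23K //.
have -> : conj23 (conj12 (lieb s13 Delta + lieb s23 Delta)) = T.
  rewrite involution_conjD 2!conj12l c12_13 c12_23.
  by rewrite involution_conjD 2!conj23l c23_13 c23_23 l23 addrC.
have -> : conj12 (conj23 (lieb s13 Delta + lieb s23 Delta)) =
    - lieb s12 Delta - lieb s13 Delta.
  rewrite involution_conjD 2!conj23l c23_13 c23_23 l23.
  by rewrite involution_conjB 2!conj12l c12_12 c12_23 l12.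
rewrite c12_12 involution_conjB involution_conjZ -/flip13 c23_12 c12_13.
rewrite liebDl liebZl comm13 scaler0 add0r liebNl /T.
(* Bracketing the Yang-Baxter equation with [Delta] and expanding by Jacobi gives exactly the
   remaining terms. *)
have := congr1 (fun M => lieb M Delta) s_cyb; rewrite lieb0l /cyb.
rewrite 2!liebDl 3!lieb_jacobi -/s12 -/s13 -/s23 => <-.
move: (lieb s12 Delta) (lieb s13 Delta) (lieb s23 Delta) => L12 L13 L23.
rewrite 3!liebDr 3!liebNr.
move: (lieb s12 L13) (lieb s12 L23) (lieb s13 L12) => x1 x2 x3.
move: (lieb s13 L23) (lieb s23 L12) (lieb s23 L13) => x4 x5 x6.
by apply/matrixP=> i j; rewrite !mxE; ring.
Qed.

(** For a pure tensor, [s_12, A (x) 1 (x) B + 1 (x) A (x) B] = [s, A (x) 1 + 1 (x) A] (x) B. So the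
    first term of the cyclic sum is the iterated cobracket, for any decomposition; the other two are
    its cyclic permutations. *)
Lemma coboundary_coJacobi m (A B : 'I_m -> 'M[R]_n) p (C D : 'I_m -> 'I_p -> 'M[R]_n) :
  coboundary s a = \sum_i A i *t B i ->
  (forall i, coboundary s (A i) = \sum_j C i j *t D i j) ->
  \sum_i \sum_j (C i j *t D i j *t B i + D i j *t B i *t C i j
                 + B i *t C i j *t D i j) = 0.
Proof.
move=> AB CD; have := cobracket_cyclic_sum.
have -> : lieb (emb12 s) (emb13 (coboundary s a) + emb23 (coboundary s a)) =
    \sum_i \sum_j C i j *t D i j *t B i.
  rewrite AB !(big_morph emb13 emb13D (id1 := 0)) ?(big_morph emb23 emb23D (id1 := 0)).
  - rewrite -big_split /= (big_morph (lieb (emb12 s)) (liebDr _) (id1 := 0)).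
      apply: eq_bigr => i _; rewrite -tensmx_suml -CD.
      rewrite /emb23 /emb13 /emb12 -[A i *t B i *t _]/(A i *t B i *t 1%:M).
      rewrite conj23_tens conj12_tens -tensmxDl -/(diag_act (A i)).
      rewrite /lieb !tensmx_mul mulmx1 mul1mx /coboundary /lieb.
      by rewrite tensmxDl tensmxNl.
    by rewrite /lieb mulmx0 mul0mx subrr.
  - by rewrite /emb23 /emb13 /emb12 tens0mx /involution_conj !(mulmx0, mul0mx).
  - by rewrite /emb13 /emb12 tens0mx /involution_conj !(mulmx0, mul0mx).
move=> /= E; rewrite -[RHS]E !involution_conj_sum -!big_split /=.
apply: eq_bigr => i _; rewrite !involution_conj_sum -!big_split /=.
apply: eq_bigr => j _.
by rewrite conj12_tens !conj23_tens conj12_tens.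
Qed.

End CoJacobi.
End TripleTensors.
(** * The standard r-matrix *)

Section StandardR.
Variables (R : fieldType) (n : nat).
Hypothesis char0 : [pchar R] =i pred0.

Let natr_eq0 (k : nat) : ((k%:R : R) == 0) = (k == 0)%N.
Proof. by have /pcharf0P -> := char0. Qed.

Let half : 2%:R^-1 + 2%:R^-1 = 1 :> R.
Proof. by rewrite -[RHS](@mulfV _ 2%:R) ?natr_eq0 // mulr_natl mulr2n. Qed.

Let natr_inj : injective (fun k : nat => k%:R : R).
Proof.
move=> k l; wlog kl : k l / (k <= l)%N => [H|].
  by case/orP: (leq_total k l) => ? e; [|apply/esym]; apply: H.
move=> /esym/eqP; rewrite -subr_eq0 -natrB // natr_eq0 subn_eq0 => lk.
by apply/eqP; rewrite eqn_leq kl.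
Qed.

(* [std_r] differs from [r_DJ h] by the scalar matrix [-1/(2n)], for every
   orthonormal basis [h]: see [coboundary_Ad2_r_DJ]. *)
Definition std_r : 'M[R]_(n * n) :=
  2%:R^-1 *: (\sum_i delta_mx i i *t delta_mx i i)
  + \sum_(i < n) \sum_(j < n | (i < j)%N) delta_mx i j *t delta_mx j i.

(** The Heaviside function of i - j with value 1/2 at 0: the factor that [std_r] introduces when it
    exchanges two basis vectors, see [std_r_bvec]. *)
Definition std_coef (i j : 'I_n) : R :=
  if (j < i)%N then 1 else if i == j then 2%:R^-1 else 0.

Lemma std_coefii i : std_coef i i = 2%:R^-1.
Proof. by rewrite /std_coef ltnn eqxx. Qed.

Lemma std_coefC i j : std_coef i j = 1 - std_coef j i.
Proof.
rewrite /std_coef -!val_eqE /=.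
case: (ltngtP i j); rewrite ?subr0 ?subrr //.
by rewrite -[X in X - _]half addrK.
Qed.

Lemma std_rE :
  std_r = \sum_i \sum_j std_coef j i *: (delta_mx i j *t delta_mx j i).
Proof.
rewrite /std_r scaler_sumr -big_split; apply: eq_bigr => i _ /=.
rewrite [RHS](bigD1 i) //= std_coefii; congr (_ + _).
rewrite big_mkcond [RHS]big_mkcond; apply: eq_bigr => j _.
rewrite /std_coef -val_eqE /=.
by case: ltngtP; rewrite ?scale1r ?scale0r.
Qed.

Lemma std_r_flip : std_r + involution_conj flip std_r = flip.
Proof.
rewrite std_rE !involution_conj_sum.
under [X in _ + X]eq_bigr => i _ do rewrite involution_conj_sum.
rewrite [X in _ + X]exchange_big -big_split; apply: eq_bigr => i _ /=.
rewrite -big_split; apply: eq_bigr => j _ /=.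
rewrite involution_conjZ flip_conj_tens -scalerDl.
by rewrite (std_coefC i j) addrC subrK scale1r.
Qed.

(** Transposing E_ij (x) E_ji has the same effect as exchanging its factors. *)
Lemma trmx_std_r : std_r^T = flip - std_r.
Proof.
rewrite -[X in X - _]std_r_flip addrC addKr std_rE raddf_sum involution_conj_sum.
apply: eq_bigr => i _; rewrite raddf_sum involution_conj_sum.
apply: eq_bigr => j _; rewrite involution_conjZ flip_conj_tens /=.
by rewrite linearZ /= trmx_tens !trmx_delta.
Qed.

(** E_ij E_ji = E_ii, and n - i - 1 indices j exceed i; the Cartan part contributes 1/2. *)
Lemma mulmap_std_r :
  mulmap std_r = diag_mx (\row_i (2%:R^-1 + (n - i.+1)%:R)).
Proof.
rewrite /std_r mulmapD mulmapZ !mulmap_sum diag_mx_sum_delta.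
rewrite scaler_sumr -big_split; apply: eq_bigr => i _ /=.
rewrite mulmap_tens mul_delta_mx mulmap_sum mxE scalerDl; congr (_ + _).
under eq_bigr => j _ do rewrite mulmap_tens mul_delta_mx.
rewrite sumr_const scaler_nat; congr (_ *+ _).
rewrite -sum1_card -(big_geq_mkord _ _ (fun=> true) (fun=> 1%N)) sum_nat_const_nat.
by rewrite muln1.
Qed.

(** In characteristic zero the diagonal entries of [mulmap std_r] are pairwise distinct. *)
Lemma comm_mulmap_std_r (M : 'M[R]_n) :
  M *m mulmap std_r = mulmap std_r *m M -> is_diag_mx M.
Proof.
rewrite mulmap_std_r => MT; apply/is_diag_mxP => i j ij.
have /matrixP/(_ i j) := MT; rewrite mul_mx_diag mul_diag_mx !mxE.
move/eqP; rewrite mulrC -subr_eq0 -mulrBl mulf_eq0 => /orP[|/eqP //].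
rewrite opprD addrACA subrr add0r subr_eq0 => /eqP/natr_inj/eqP.
rewrite eqn_sub2lE ?ltn_ord // eqSS => /eqP/val_inj ji.
by rewrite ji eqxx in ij.
Qed.

(** Every E_ij (x) E_ji has weight zero: the factors d_i / d_j and d_j / d_i cancel. *)
Lemma Ad2_diag_std_r (D : 'M[R]_n) : D \in unitmx -> is_diag_mx D ->
  Ad2 D std_r = std_r.
Proof.
move=> uD /diag_mxP[d Dd].
rewrite /Ad2; suff -> : (D *t D) *m std_r = std_r *m (D *t D).
  by rewrite -mulmxA tensmxV // mulmx1.
rewrite std_rE mulmx_sumr mulmx_suml; apply: eq_bigr => i _.
rewrite mulmx_sumr mulmx_suml; apply: eq_bigr => j _.
rewrite -scalemxAr -scalemxAl !tensmx_mul Dd.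
have El k l : diag_mx d *m delta_mx k l = d 0 k *: delta_mx k l.
  apply/matrixP=> x y; rewrite mul_diag_mx !mxE.
  by have [->|] := eqVneq x k; rewrite // !mulr0.
have Er k l : delta_mx k l *m diag_mx d = d 0 l *: delta_mx k l.
  apply/matrixP=> x y; rewrite mul_mx_diag !mxE mulrC.
  by have [->|] := eqVneq y l; rewrite ?andbF // !mulr0.
by rewrite !El !Er !tensmxZl !tensmxZr !scalerA [d 0 j * _]mulrC.
Qed.

Lemma std_r_bvec (k l : 'I_n) :
  std_r *m (bvec R k *t bvec R l) = std_coef k l *: (bvec R l *t bvec R k).
Proof.
rewrite std_rE mulmx_suml (bigD1 l) //= mulmx_suml (bigD1 k) //=.
have E i j : delta_mx i j *t delta_mx j i *m (bvec R k *t bvec R l) =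
    ((k == j) && (l == i))%:R *: (bvec R i *t bvec R j).
  rewrite tensmx_mul !delta_mulmx_col tensmxZl tensmxZr scalerA !mxE !eqxx.
  by rewrite !andbT -natrM mulnb ![j == _]eq_sym ![i == _]eq_sym.
rewrite -scalemxAl E !eqxx scale1r !big1 ?addr0 // => [i /negPf il|j /negPf jk].
  rewrite mulmx_suml big1 // => j _.
  by rewrite -scalemxAl E [l == i]eq_sym il andbF scale0r scaler0.
by rewrite -scalemxAl E [k == j]eq_sym jk scale0r scaler0.
Qed.

Lemma cyb_std_r : cyb std_r = 0.
Proof.
pose e (a b c : 'I_n) := bvec R a *t bvec R b *t bvec R c.
have r12 a b c : emb12 std_r *m e a b c = std_coef a b *: e b a c.
  by rewrite tensmx_mul mul1mx std_r_bvec tensmxZl.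
have r13 a b c : emb13 std_r *m e a b c = std_coef a c *: e c b a.
  rewrite /emb13 /involution_conj -!mulmxA flip23_col r12 -scalemxAr.
  by rewrite flip23_col.
have r23 a b c : emb23 std_r *m e a b c = std_coef b c *: e a c b.
  rewrite /emb23 /involution_conj -2!mulmxA flip12_col r13 -scalemxAr.
  by rewrite flip12_col.
apply: eq_mx_on_basis3 => a b c; rewrite -/(e a b c) mul0mx /cyb /lieb.
move: (emb12 _) (emb13 _) (emb23 _) r12 r13 r23 => R12 R13 R23 r12 r13 r23.
rewrite !mulmxDl !mulNmx -!mulmxA !(r12, r13, r23).
rewrite -!scalemxAr !(r12, r13, r23) !scalerA.
(* The six products send the basis vector to multiples of its two cyclic rearrangements, and the
   total coefficients are [G] and [- G]. *)
pose G := std_coef a c * (1 - std_coef b c - std_coef a b)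
          + std_coef b c * std_coef a b.
transitivity (G *: (e b c a - e c a b)).
  rewrite (std_coefC b a) (std_coefC c b) /G.
  move: (e b c a) (e c a b) => x y.
  by apply/matrixP=> i j; rewrite !mxE; ring.
have neqE x y : x != y -> std_coef x y = (y < x)%N%:R.
  by rewrite /std_coef -val_eqE /=; case: ltngtP.
(* If all indices agree, [G] is 1/4 but the two vectors coincide. In every other case [G]
   vanishes. *)
have [ab|nab] := eqVneq a b; have [bc|nbc] := eqVneq b c.
- by rewrite ab bc subrr scaler0.
- suff -> : G = 0 by rewrite scale0r.
  rewrite /G ab std_coefii neqE //; move: 2%:R^-1 => half2.
  by case: (c < b)%N => /=; ring.
- suff -> : G = 0 by rewrite scale0r.
  rewrite /G -bc std_coefii neqE //; move: 2%:R^-1 => half2.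
  by case: (b < a)%N => /=; ring.
suff -> : G = 0 by rewrite scale0r.
have [ac|nac] := eqVneq a c.
  rewrite /G -ac std_coefii (std_coefC b a) neqE //; move: 2%:R^-1 => half2.
  by case: (b < a)%N => /=; ring.
rewrite /G !neqE //.
have [cb|bc] := ltnP c b; have [ba|ab] := ltnP b a.
- by rewrite (ltn_trans cb ba) /=; ring.
- by rewrite /=; ring.
- by rewrite /=; ring.
by rewrite ltnNge (leq_trans ab bc) /=; ring.
Qed.

End StandardR.

(** * The Cartan part of the r-matrix and the trace *)

Section CartanPart.
Variables (R : fieldType) (n : nat).
Hypotheses (char0 : [pchar R] =i pred0) (n_gt0 : (0 < n)%N).
Implicit Types (A B X T : 'M[R]_n) (s : 'M[R]_(n * n)).

Let n_neq0 : n%:R != 0 :> R.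
Proof. by have /pcharf0P -> := char0; rewrite -lt0n. Qed.

(** The orthogonal projection of E_ii to the traceless matrices for the trace form. *)
Definition cartan_elt (i : 'I_n) : 'M[R]_n := delta_mx i i - n%:R^-1%:M.

Lemma mxtrace_cartan_elt i : \tr (cartan_elt i) = 0.
Proof.
rewrite raddfB /= mxtrace_scalar -[X in _ - X]mulr_natl divff //.
rewrite /mxtrace (bigD1 i) //= mxE eqxx big1 ?addr0 ?subrr // => j /negPf ji.
by rewrite mxE ji.
Qed.

Lemma sum_delta_diag : \sum_i delta_mx i i = 1%:M :> 'M[R]_n.
Proof.
rewrite -diag_const_mx diag_mx_sum_delta; apply: eq_bigr => i _.
by rewrite mxE scale1r.
Qed.

Lemma sum_cartan_elt :
  \sum_i cartan_elt i *t cartan_elt i =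
  \sum_i delta_mx i i *t delta_mx i i - n%:R^-1%:M.
Proof.
set c : R := n%:R^-1.
have E i : cartan_elt i *t cartan_elt i = delta_mx i i *t delta_mx i i
    - c *: (delta_mx i i *t 1%:M) - c *: (1%:M *t delta_mx i i) + (c * c)%:M.
  rewrite /cartan_elt -/c -[c%:M]scalemx1 tensmxDl !tensmxDr !(tensmxNl, tensmxNr).
  rewrite !(tensmxZl, tensmxZr) scalerA opprK tens11 [(c * c) *: _]scalemx1.
  by rewrite !addrA.
under eq_bigr => i _ do rewrite E.
rewrite big_split /= 2!sumrB -!scaler_sumr -tensmx_suml -tensmx_sumr.
rewrite sum_delta_diag tens11 sumr_const card_ord scalemx1.
rewrite -raddfMn /= -mulrnAl -[c *+ n]mulr_natl divff // mul1r.
by rewrite subrK.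
Qed.

(** The numbers [h j i i] are both the coordinates of [cartan_elt i] in the basis [h] and
    coefficients of [h j] on the [cartan_elt i]. Substituting one expansion into the other shows
    that the sum does not depend on [h]. *)
Lemma sum_orthonormal_cartan_basis (h : 'I_n.-1 -> 'M[R]_n) :
  orthonormal_cartan_basis h ->
  \sum_i h i *t h i = \sum_i delta_mx i i *t delta_mx i i - n%:R^-1%:M.
Proof.
case=> h0 h_orth h_span; rewrite -sum_cartan_elt.
have eltE i : cartan_elt i = \sum_j h j i i *: h j.
  have [||c Ec] := h_span (cartan_elt i).
  - apply/is_diag_mxP => k l kl; rewrite !mxE -[k == l]val_eqE (negPf kl) subr0.
      case: (eqVneq k i) => //= ki; case: (eqVneq l i) => //= li.
    by rewrite ki li eqxx in kl.
  - exact: mxtrace_cartan_elt.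
  rewrite Ec; apply: eq_bigr => j _; congr (_ *: _).
  (* Pairing with [h j] extracts the coordinate; the scalar part of [cartan_elt i] pairs to zero
     because [h j] is traceless. *)
  transitivity (\tr (cartan_elt i *m h j)).
    rewrite Ec mulmx_suml raddf_sum (bigD1 j) //= big1 => [|k /negPf kj].
      by rewrite -scalemxAl mxtraceZ h_orth eqxx mulr1 addr0.
    by rewrite -scalemxAl mxtraceZ h_orth kj mulr0.
  rewrite mulmxBl raddfB /= mul_scalar_mx mxtraceZ (h0 j).2 mulr0 subr0.
  rewrite /mxtrace (bigD1 i) //= big1 ?addr0 => [|k /negPf ki].
    rewrite mxE (bigD1 i) //= big1 ?addr0 ?mxE ?eqxx ?mul1r // => k /negPf ki.
    by rewrite mxE ki andbF mul0r.
  by rewrite mxE big1 // => l _; rewrite mxE ki mul0r.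
have hE j : h j = \sum_i h j i i *: cartan_elt i.
  under eq_bigr => i _ do rewrite scalerBr.
  rewrite sumrB -scaler_suml -/(\tr (h j)) (h0 j).2 scale0r subr0.
  have [/diag_mxP[e ->] _] := h0 j; rewrite diag_mx_sum_delta.
  by apply: eq_bigr => i _; rewrite -diag_mx_sum_delta mxE eqxx mulr1n.
under eq_bigr => j _ do rewrite [X in _ *t X]hE tensmx_sumr.
rewrite exchange_big; apply: eq_bigr => i _ /=.
rewrite [X in _ = X *t _]eltE tensmx_suml; apply: eq_bigr => j _.
by rewrite tensmxZl tensmxZr.
Qed.

Lemma Ad2_scalar X c : X \in unitmx -> Ad2 X c%:M = c%:M.
Proof. by move=> uX; rewrite /Ad2 mul_mx_scalar -scalemxAl tensmxV // scalemx1. Qed.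

Lemma coboundary_Ad2_r_DJ (h : 'I_n.-1 -> 'M[R]_n) X c A :
  orthonormal_cartan_basis h -> X \in unitmx ->
  coboundary (c *: Ad2 X (r_DJ h)) A = coboundary (c *: Ad2 X (std_r R n)) A.
Proof.
move=> hh uX.
have -> : r_DJ h = std_r R n + (- (2%:R^-1 * n%:R^-1))%:M.
  rewrite /r_DJ sum_orthonormal_cartan_basis // scalerBr /std_r -addrA addrAC.
  by rewrite addrA -scalemx1 scalerA scalemx1 raddfN.
rewrite Ad2D Ad2_scalar // !coboundaryZ coboundaryD [X in _ + X]liebsl.
by rewrite addr0.
Qed.

Lemma mxtrace_lieb A B : \tr (lieb A B) = 0.
Proof. by rewrite raddfB /= mxtrace_mulC subrr. Qed.

Lemma mxtrace_Ad X A : X \in unitmx -> \tr (Ad X A) = \tr A.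
Proof. by move=> uX; rewrite /Ad mxtrace_mulC mulKmx. Qed.

(* A scalar does not change the coboundary, so the Cartan part of the r-matrix
   may be taken traceless. *)
Lemma coboundary_std_r_ind (P : 'M[R]_(n * n) -> Prop) X c A :
  X \in unitmx -> P 0 -> (forall s t, P s -> P t -> P (s + t)) ->
  (forall B C, \tr B = 0 -> \tr C = 0 -> P (B *t C)) ->
  P (coboundary (c *: Ad2 X (std_r R n)) A).
Proof.
move=> uX P0 PD PT; rewrite coboundaryZ.
pose Q s := P (c *: coboundary (Ad2 X s) A).
have QD s t : Q s -> Q t -> Q (s + t).
  by move=> Qs Qt; rewrite /Q Ad2D coboundaryD scalerDr; apply: PD.
have Q0 : Q 0.
  by rewrite /Q /Ad2 mulmx0 mul0mx [coboundary _ _]lieb0l scaler0.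
have QT B C : \tr B = 0 -> \tr C = 0 -> Q (B *t C).
  move=> B0 C0; rewrite /Q Ad2_tens /coboundary lieb_diag_act scalerDr.
  rewrite -!tensmxZl; apply: PD; apply: PT; rewrite ?mxtraceZ ?mxtrace_lieb;
  by rewrite ?mxtrace_Ad ?B0 ?C0 ?mulr0.
suff: Q (2%:R^-1 *: (\sum_i cartan_elt i *t cartan_elt i)
  + \sum_(i < n) \sum_(j < n | (i < j)%N) delta_mx i j *t delta_mx j i).
  rewrite sum_cartan_elt scalerBr addrAC -/(std_r R n) -[n%:R^-1%:M]scalemx1.
  rewrite scalerA scalemx1 -raddfN /Q Ad2D Ad2_scalar // coboundaryD.
  by rewrite [X in _ + X]liebsl addr0.
have tr_delta (i j : 'I_n) : i != j -> \tr (delta_mx i j : 'M[R]_n) = 0.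
  move=> /negPf ij; rewrite /mxtrace big1 // => k _; rewrite mxE.
  by case: eqVneq => //= ->; rewrite ij.
apply: (QD).
  rewrite scaler_sumr; apply: (big_ind Q Q0 QD) => i _.
  by rewrite -tensmxZl; apply: QT; rewrite ?mxtraceZ mxtrace_cartan_elt ?mulr0.
apply: (big_ind Q Q0 QD) => i _; apply: (big_ind Q Q0 QD) => j ij.
by apply: QT; rewrite tr_delta // -val_eqE /= neq_ltn ij ?orbT.
Qed.

(** The terms T E_ij E_ji add up to n T, and E_ij T E_ji = T_jj E_ii. The formula recovers [T], up
    to its trace, from the derivation ad T. *)
Lemma sum_lieb_delta T :
  \sum_i \sum_j lieb T (delta_mx i j) *m delta_mx j i = n%:R *: T - (\tr T)%:M.
Proof.
have E i j : delta_mx i j *m T *m delta_mx j i = T j j *: delta_mx i i.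
  apply/matrixP=> k l; rewrite mxE (bigD1 j) //= big1 ?addr0 => [|m /negPf mj].
    rewrite !mxE eqxx andTb (bigD1 j) //= big1 ?addr0 => [|m /negPf mj].
      by rewrite mxE eqxx andbT mulrAC mulrC -natrM mulnb.
    by rewrite mxE mj andbF mul0r.
  by rewrite [X in _ * X]mxE mj mulr0.
under eq_bigr => i _.
  under eq_bigr => j _ do rewrite /lieb mulmxBl -mulmxA mul_delta_mx E.
  rewrite sumrB sumr_const card_ord -scaler_suml -/(\tr T).
  over.
rewrite sumrB -scaler_sumr sum_delta_diag scalemx1; congr (_ - _).
by rewrite sumrMnl -mulmx_sumr sum_delta_diag mulmx1 scaler_nat.
Qed.

End CartanPart.

(** * Compatibility with field embeddings *)

Section BaseChange.
Variables (R S : fieldType) (f : {rmorphism R -> S}) (n : nat).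
Implicit Types (A B X : 'M[R]_n) (s : 'M[R]_(n * n)).

Lemma map_lieb m (A B : 'M[R]_m) :
  map_mx f (lieb A B) = lieb (map_mx f A) (map_mx f B).
Proof. by rewrite /lieb map_mxB !map_mxM. Qed.

Lemma map_diag_act A : map_mx f (diag_act A) = diag_act (map_mx f A).
Proof. by rewrite /diag_act map_mxD !map_mxT map_mx1. Qed.

Lemma map_coboundary s A :
  map_mx f (coboundary s A) = coboundary (map_mx f s) (map_mx f A).
Proof. by rewrite map_lieb map_diag_act. Qed.

Lemma map_Ad2 X s : map_mx f (Ad2 X s) = Ad2 (map_mx f X) (map_mx f s).
Proof. by rewrite /Ad2 !map_mxM !map_mxT map_invmx. Qed.

Lemma map_mulmap s : map_mx f (mulmap s) = mulmap (map_mx f s).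
Proof.
apply/matrixP=> i j; rewrite !mxE rmorph_sum; apply: eq_bigr => k _.
by rewrite mxE.
Qed.

Lemma map_std_r : map_mx f (std_r R n) = std_r S n.
Proof.
rewrite /std_r map_mxD map_mxZ fmorphV rmorph_nat; congr (_ *: _ + _).
  by rewrite raddf_sum; apply: eq_bigr => i _; rewrite /= map_mxT map_delta_mx.
rewrite raddf_sum; apply: eq_bigr => i _ /=.
by rewrite raddf_sum; apply: eq_bigr => j _; rewrite /= map_mxT !map_delta_mx.
Qed.

End BaseChange.
(** * Bialgebra structures on su *)

Section UnitaryBialgebras.
Variables (F : fieldType) (d : F) (K : splittingFieldType F) (sqrtd : K).
Variables (sigma : gal_of {:K}) (n : nat).
Hypothesis char0 : [pchar F] =i pred0.
Hypothesis d_neq0 : d != 0.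
Hypothesis sqrtd2 : sqrtd ^+ 2 = d%:A.
Hypothesis K_gen : <<1; sqrtd>>%VS = {:K}%VS.
Hypothesis sigma_nontriv : sigma != 1%g.
Hypothesis n_gt0 : (0 < n)%N.
Implicit Types (A B C T X Y Q : 'M[K]_n) (s t : 'M[K]_(n * n)) (a b : su sigma n).

Lemma pchar_ext : [pchar K] =i pred0.
Proof. by move=> p; rewrite (fmorph_pchar (in_alg K)). Qed.

Let natK (k : nat) : ((k%:R : K) == 0) = (k == 0)%N.
Proof. by have /pcharf0P -> := pchar_ext. Qed.

Let two_neq0 : 2%:R != 0 :> K.
Proof. by rewrite natK. Qed.

Lemma sqrtd_neq0 : sqrtd != 0.
Proof.
apply: contra_neq d_neq0 => s0; move/eqP: sqrtd2.
by rewrite s0 expr0n /= eq_sym scaler_eq0 oner_eq0 orbF => /eqP.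
Qed.

(** Induction on a polynomial in [sqrtd] in Horner form: multiplying a + b sqrt d by sqrt d gives b
    d + a sqrt d. *)
Lemma quadratic_span (x : K) : exists a b : F, x = a%:A + b%:A * sqrtd.
Proof.
have : x \in <<1; sqrtd>>%VS by rewrite K_gen memvf.
case/Fadjoin_polyP => p /polyOver1P[q ->] ->.
elim/poly_ind: q => [|q c [a [b E]]].
  by exists 0, 0; rewrite rmorph0 horner0 scale0r mul0r addr0.
exists (c + b * d), a; rewrite rmorphD rmorphM /= map_polyX map_polyC /=.
rewrite hornerD hornerM hornerX hornerC E mulrDl -mulrA -expr2 sqrtd2.
rewrite -[(c + _)%:A]/(in_alg K _) rmorphD rmorphM /= addrC -addrA.
by rewrite [X in _ + X]addrC.
Qed.

Lemma gal_alg (a : F) : sigma a%:A = a%:A.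
Proof. exact: rmorph_alg. Qed.

(** The image is a square root of d; if it were [sqrtd] itself, [sigma] would fix all of K. *)
Lemma gal_sqrtd : sigma sqrtd = - sqrtd.
Proof.
have : (sigma sqrtd) ^+ 2 == sqrtd ^+ 2 by rewrite -rmorphXn /= sqrtd2 gal_alg.
rewrite eqf_sqr => /orP[/eqP E|/eqP //]; case/negP: sigma_nontriv.
apply/gal_eqP => x _; rewrite gal_id.
have [a [b ->]] := quadratic_span x.
by rewrite rmorphD rmorphM /= !gal_alg E.
Qed.

Lemma galK (x : K) : sigma (sigma x) = x.
Proof.
have [a [b ->]] := quadratic_span x.
by rewrite !(rmorphD, rmorphM) /= !gal_alg gal_sqrtd rmorphN /= gal_sqrtd opprK.
Qed.

Lemma gal_fixed (x : K) : sigma x = x -> exists a : F, x = a%:A.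
Proof.
have [a [b ->]] := quadratic_span x; rewrite rmorphD rmorphM /= !gal_alg gal_sqrtd.
move/eqP; rewrite mulrN -subr_eq0 opprD addrACA subrr add0r -opprD oppr_eq0.
rewrite -mulr2n -mulr_natl mulf_eq0 (negPf two_neq0) /= => /eqP ->.
by exists a; rewrite addr0.
Qed.

(** * The adjoint, and su as a form of sl(n, K) *)

Lemma adjmxD m (A B : 'M[K]_m) : adjmx sigma (A + B) = adjmx sigma A + adjmx sigma B.
Proof. by apply/matrixP=> i j; rewrite !mxE rmorphD. Qed.

Lemma adjmx0 m : adjmx sigma (0 : 'M[K]_m) = 0.
Proof. by apply/matrixP=> i j; rewrite !mxE rmorph0. Qed.

Lemma adjmx1 m : adjmx sigma (1%:M : 'M[K]_m) = 1%:M.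
Proof. by rewrite /adjmx map_mx1 trmx1. Qed.

Lemma adjmx_scale m (c : K) (A : 'M[K]_m) :
  adjmx sigma (c *: A) = sigma c *: adjmx sigma A.
Proof. by apply/matrixP=> i j; rewrite !mxE rmorphM. Qed.

Lemma adjmxK m (A : 'M[K]_m) : adjmx sigma (adjmx sigma A) = A.
Proof. by apply/matrixP=> i j; rewrite !mxE galK. Qed.

Lemma adjmx_sum m I e P (f : I -> 'M[K]_m) :
  adjmx sigma (\sum_(i <- e | P i) f i) = \sum_(i <- e | P i) adjmx sigma (f i).
Proof. by apply: big_morph; [exact: adjmxD | exact: adjmx0]. Qed.

Lemma mxtrace_adjmx m (A : 'M[K]_m) : \tr (adjmx sigma A) = sigma (\tr A).
Proof. by rewrite /adjmx mxtrace_tr rmorph_sum; apply: eq_bigr => i _; rewrite mxE. Qed.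

Lemma adjmx_tens A B : adjmx sigma (A *t B) = adjmx sigma A *t adjmx sigma B.
Proof. by rewrite /adjmx map_mxT trmx_tens. Qed.

Lemma adjmx_unit m (A : 'M[K]_m) : (adjmx sigma A \in unitmx) = (A \in unitmx).
Proof. by rewrite /adjmx unitmx_tr map_unitmx. Qed.

Lemma adjmx_inv m (A : 'M[K]_m) : A \in unitmx ->
  adjmx sigma (invmx A) = invmx (adjmx sigma A).
Proof. by move=> uA; rewrite /adjmx map_invmx trmx_inv. Qed.

Lemma adjmx_su a : adjmx sigma (val a) = - val a.
Proof. by case/suP: (valP a). Qed.

Lemma adjmx_lieb m (A B : 'M[K]_m) :
  adjmx sigma (lieb A B) = lieb (adjmx sigma B) (adjmx sigma A).
Proof. by rewrite /lieb adjmx_is_additive !adjmxM. Qed.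

(** Half of A - A^* is skew-adjoint, and half of A + A^* becomes so after division by sqrt d, which
    [sigma] negates. *)
Lemma su_decomp A : \tr A = 0 ->
  exists P Q : su sigma n, A = val P + sqrtd *: val Q.
Proof.
move=> A0.
have h2 : sigma 2%:R^-1 = 2%:R^-1 by rewrite fmorphV rmorph_nat.
have h2d : sigma (2%:R^-1 / sqrtd) = - (2%:R^-1 / sqrtd).
  by rewrite rmorphM !fmorphV rmorph_nat /= gal_sqrtd invrN mulrN.
have tA : \tr (adjmx sigma A) = 0 by rewrite mxtrace_adjmx A0 rmorph0.
have P_su : 2%:R^-1 *: (A - adjmx sigma A) \in @su_pred _ _ sigma n.
  apply/suP; split; first by rewrite mxtraceZ raddfB /= A0 tA subrr mulr0.
  by rewrite adjmx_scale adjmx_is_additive adjmxK h2 -scalerN opprB.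
have Q_su : (2%:R^-1 / sqrtd) *: (A + adjmx sigma A) \in @su_pred _ _ sigma n.
  apply/suP; split; first by rewrite mxtraceZ raddfD /= A0 tA addr0 mulr0.
  by rewrite adjmx_scale adjmxD adjmxK h2d scaleNr addrC.
exists (Su P_su), (Su Q_su) => /=.
rewrite scalerA mulrCA mulfV ?sqrtd_neq0 // mulr1 -scalerDr addrC.
by rewrite addrACA subrr addr0 -mulr2n -[A *+ 2]scaler_nat scalerA mulVf // scale1r.
Qed.

Lemma su_trace_decomp A : exists (P Q : su sigma n) (c : K),
  A = val P + sqrtd *: val Q + c%:M.
Proof.
have : \tr (A - (\tr A / n%:R)%:M) = 0.
  rewrite raddfB /= mxtrace_scalar -[X in _ - X]mulr_natl mulrCA divff ?mulr1 ?subrr //.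
  by rewrite natK -lt0n.
by move=> /su_decomp[P [Q E]]; exists P, Q, (\tr A / n%:R); rewrite -E subrK.
Qed.

(** Together with the scalars, su spans M_n(K) over K, so ad T vanishes; [sum_lieb_delta] then gives
    n T = 0. *)
Lemma lieb_su_eq0 T : (forall a, lieb T (val a) = 0) -> \tr T = 0 -> T = 0.
Proof.
move=> T0 trT; have T0' A : lieb T A = 0.
  have [P [Q [c ->]]] := su_trace_decomp A.
  by rewrite !liebDr liebZr !T0 scaler0 !add0r liebC liebsl oppr0.
have := sum_lieb_delta T; rewrite trT raddf0 subr0.
under eq_bigr => i _ do (under eq_bigr => j _ do rewrite T0' mul0mx).
rewrite big1 => [|i _].
  by move/esym/eqP; rewrite scaler_eq0 natK -[n == 0%N]negbK -lt0n n_gt0 => /eqP.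
by rewrite big1.
Qed.

Lemma lieb_su_inj S T : (forall a, lieb S (val a) = lieb T (val a)) ->
  \tr S = \tr T -> S = T.
Proof.
move=> ST trST; apply/eqP; rewrite -subr_eq0; apply/eqP/lieb_su_eq0 => [a|].
  by rewrite liebDl liebNl ST subrr.
by rewrite raddfB /= trST subrr.
Qed.

(** * Cobrackets of Drinfeld-Jimbo type over K *)

Local Notation r0 := (std_r K n).
Local Notation T0 := (mulmap (std_r K n)).

(** Formed with [std_r], which has entries in K, since the basis [h] in [r_DJ h] is given only over
    the larger field. *)
Definition DJ_cobracket X a : 'M[K]_(n * n) :=
  coboundary (sqrtd *: Ad2 X r0) (val a).

Lemma mulmap_DJ_cobracket X a : X \in unitmx ->
  mulmap (DJ_cobracket X a) = lieb (sqrtd *: Ad X T0) (val a).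
Proof. by move=> uX; rewrite mulmap_coboundary mulmapZ mulmap_Ad2. Qed.

Lemma DJ_cobracket_inj X Y : X \in unitmx -> Y \in unitmx ->
  DJ_cobracket X = DJ_cobracket Y -> is_diag_mx (invmx X *m Y).
Proof.
move=> uX uY XY; apply: (comm_mulmap_std_r pchar_ext).
have : sqrtd *: Ad X T0 = sqrtd *: Ad Y T0.
  apply: lieb_su_inj => [a|]; last by rewrite !mxtraceZ !mxtrace_Ad.
  by rewrite -(mulmap_DJ_cobracket a uX) -(mulmap_DJ_cobracket a uY) XY.
move/(scalerI sqrtd_neq0); rewrite /Ad => E.
have : X *m T0 *m invmx X *m Y = Y *m T0 by rewrite E mulmxKV.
by move/(congr1 (mulmx (invmx X))); rewrite !mulmxA mulVmx // mul1mx.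
Qed.

Lemma DJ_cobracket_mul_diag X D : X \in unitmx -> D \in unitmx ->
  is_diag_mx D -> DJ_cobracket (X *m D) = DJ_cobracket X.
Proof.
move=> uX uD dD; apply/funext => a; rewrite /DJ_cobracket (Ad2M _ uX uD).
by rewrite Ad2_diag_std_r.
Qed.

Lemma DJ_cobracket_gauge X Q (uQ : unitary sigma Q) : X \in unitmx ->
  Ad2 Q \o DJ_cobracket X \o su_Ad_inv uQ = DJ_cobracket (Q *m X).
Proof.
move=> uX; apply/funext => a; have [Qu _] := uQ.
rewrite /= /DJ_cobracket Ad2_coboundary //= Ad_invK // Ad2Z.
by rewrite Ad2M.
Qed.

Lemma su_tens20 : su_tens2 sigma (0 : 'M[K]_(n * n)).
Proof. by exists 0%N, (fun=> 0), (fun=> 0); rewrite big_ord0. Qed.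

Lemma su_tens2D s t : su_tens2 sigma s -> su_tens2 sigma t ->
  su_tens2 sigma (s + t).
Proof.
move=> [m [A [B ->]]] [p [C [D ->]]].
pose g (A : 'I_m -> su sigma n) (C : 'I_p -> su sigma n) (i : 'I_(m + p)) :=
  match fintype.split i with inl k => A k | inr k => C k end.
exists (m + p)%N, (g A C), (g B D); rewrite big_split_ord /=.
have gl u v k : g u v (lshift p k) = u k.
  by rewrite /g (unsplitK (inl k : 'I_m + 'I_p)).
have gr u v k : g u v (rshift m k) = v k.
  by rewrite /g (unsplitK (inr k : 'I_m + 'I_p)).
by congr (_ + _); apply: eq_bigr => k _; rewrite ?gl ?gr.
Qed.

Lemma su_tens2_pure a b : su_tens2 sigma (val a *t val b).
Proof. by exists 1%N, (fun=> a), (fun=> b); rewrite big_ord1. Qed.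

Lemma adjmx_su_tens2 t : su_tens2 sigma t -> adjmx sigma t = t.
Proof.
move=> [m [A [B ->]]]; rewrite adjmx_sum; apply: eq_bigr => i _.
by rewrite adjmx_tens !adjmx_su tensmxNl tensmxNr opprK.
Qed.

(** Tensors over su are self-adjoint, as two signs cancel, whereas sqrt d changes sign.
    Self-adjointness of the sum thus forces its sqrt d part to vanish. *)
Lemma su_tens2_descent s t :
  su_tens2 sigma s -> su_tens2 sigma t ->
  adjmx sigma (s + sqrtd *: t) = s + sqrtd *: t ->
  su_tens2 sigma (s + sqrtd *: t).
Proof.
move=> Ss St; rewrite adjmxD adjmx_scale !adjmx_su_tens2 // gal_sqrtd.
move/addrI/eqP; rewrite scaleNr eq_sym -subr_eq0 opprK -mulr2n -scaler_nat.
by rewrite scaler_eq0 (negPf two_neq0) /= => /eqP ->; rewrite addr0.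
Qed.

Lemma Ad2_flip Y : Y \in unitmx -> Ad2 Y flip = flip.
Proof.
by move=> uY; rewrite /Ad2 -flip_tens -mulmxA tensmxV // mulmx1.
Qed.

Lemma Ad2_std_r_flip X : X \in unitmx ->
  sqrtd *: Ad2 X r0 + involution_conj flip (sqrtd *: Ad2 X r0) = sqrtd *: flip.
Proof.
move=> uX; rewrite involution_conjZ -scalerDr; congr (_ *: _).
have -> : involution_conj flip (Ad2 X r0) = Ad2 X (involution_conj flip r0).
  rewrite /involution_conj /Ad2 !mulmxA flip_tens -!mulmxA.
  by rewrite flip_tens.
by rewrite -Ad2D (std_r_flip n pchar_ext) Ad2_flip.
Qed.

Lemma flip_conj_DJ_cobracket X a : X \in unitmx ->
  involution_conj flip (DJ_cobracket X a) = - DJ_cobracket X a.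
Proof.
move=> uX; rewrite /DJ_cobracket /coboundary involution_conj_lieb ?flipK //.
rewrite (involution_conj_id (flipK _ _) (flip_diag_act _)).
have /(canRL (addKr _)) -> := Ad2_std_r_flip uX.
rewrite liebDl liebNl !liebZl.
by rewrite [lieb flip _]/lieb flip_diag_act subrr scaler0 addr0.
Qed.

Lemma map_std_r_gal : map_mx sigma r0 = r0.
Proof. exact: map_std_r. Qed.

(** With X^* X = M, the adjoint of X^-1 is X M^-1, whose diagonal factor stabilizes [r0]. As [r0]
    has adjoint [flip - r0] and sqrt d changes sign, the adjoint of s = sqrt d Ad_X (x) Ad_X ([r0])
    is s minus a multiple of the invariant [flip]. *)
Lemma adjmx_DJ_cobracket X a : DJ_cocycle sigma X ->
  adjmx sigma (DJ_cobracket X a) = DJ_cobracket X a.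
Proof.
move=> [uX [D [dD uD XD]]]; set M := map_mx _ D in XD.
have uM : M \in unitmx by rewrite map_unitmx.
have dM : is_diag_mx (invmx M).
  have /diag_mxP[e De] := dD.
  have Me : M = diag_mx (map_mx (in_alg K) e) by rewrite /M De map_diag_mx.
  (* The inverse of [M] is diagonal since it commutes with [T0], as [M] does. *)
  apply: (comm_mulmap_std_r pchar_ext); apply: (can_inj (mulKmx uM)).
  rewrite mulKVmx // mulmxA.
  have -> : M *m T0 = T0 *m M.
    by rewrite Me mulmap_std_r // diag_mxC.
  by rewrite mulmxK.
have X' : adjmx sigma X = M *m invmx X by rewrite -XD mulmxK.
have Xi' : adjmx sigma (invmx X) = X *m invmx M.
  by rewrite adjmx_inv // X' invmxM ?unitmx_inv // invmxK.
have r0' : adjmx sigma r0 = flip - r0.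
  by rewrite /adjmx map_std_r_gal (trmx_std_r n pchar_ext).
have s' : adjmx sigma (sqrtd *: Ad2 X r0) = sqrtd *: Ad2 X r0 - sqrtd *: flip.
  rewrite adjmx_scale gal_sqrtd /Ad2 !adjmxM !adjmx_tens r0' Xi' X' mulmxA.
  have -> : M *m invmx X = invmx (X *m invmx M).
    by rewrite invmxM ?unitmx_inv // invmxK.
  rewrite -[_ *m _ *m _]/(Ad2 (X *m invmx M) (flip - r0)) Ad2M ?unitmx_inv //.
  rewrite !Ad2D !Ad2N Ad2_diag_std_r ?unitmx_inv //.
  by rewrite !Ad2_flip ?unitmx_inv // scaleNr scalerBr opprB.
rewrite /DJ_cobracket /coboundary adjmx_lieb s' {1}/diag_act adjmxD !adjmx_tens.
rewrite adjmx1 adjmx_su -/(diag_act (- val a)) diag_actN liebC liebNr opprK.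
rewrite liebDl liebNl !liebZl [lieb flip _]/lieb flip_diag_act subrr.
by rewrite scaler0 subr0.
Qed.

(** The value is a sum of tensors of traceless matrices. Splitting both factors by [su_decomp] gives
    s + sqrt d t with s and t over su, and self-adjointness allows descent. *)
Lemma DJ_cobracket_su_tens2 X a : DJ_cocycle sigma X ->
  su_tens2 sigma (DJ_cobracket X a).
Proof.
move=> cX; have [uX _] := cX.
pose P u := exists s t, [/\ su_tens2 sigma s, su_tens2 sigma t & u = s + sqrtd *: t].
suff [s [t [Ss St E]]] : P (DJ_cobracket X a).
  by rewrite E; apply: su_tens2_descent => //; rewrite -E adjmx_DJ_cobracket.
apply: (coboundary_std_r_ind pchar_ext n_gt0 (P := P)) => //.
- by exists 0, 0; split; rewrite ?scaler0 ?addr0 //; apply: su_tens20.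
- move=> s t [s1 [s2 [S1 S2 ->]]] [t1 [t2 [S3 S4 ->]]].
  exists (s1 + t1), (s2 + t2); split; try exact: su_tens2D.
  by rewrite scalerDr addrACA.
move=> B C /su_decomp[B1 [B2 ->]] /su_decomp[C1 [C2 ->]].
exists (val B1 *t val C1 + val (d *: B2) *t val C2),
       (val B1 *t val C2 + val B2 *t val C1); split.
- by apply: su_tens2D; apply: su_tens2_pure.
- by apply: su_tens2D; apply: su_tens2_pure.
rewrite tensmxDl !tensmxDr !(tensmxZl, tensmxZr) scalerA -expr2 sqrtd2.
rewrite scalerDr -!addrA; congr (_ + _).
by rewrite [RHS]addrC -addrA.
Qed.

Lemma DJ_cobracket_bialgebra X : DJ_cocycle sigma X ->
  lie_bialgebra (DJ_cobracket X).
Proof.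
move=> cX; have [uX _] := cX; split.
- by move=> a; apply: DJ_cobracket_su_tens2.
- by move=> c a b; rewrite /DJ_cobracket coboundary_linear.
- move=> a m A B E; rewrite -flip_conj_DJ_cobracket // E involution_conj_sum.
  by apply: eq_bigr => i _; rewrite flip_conj_tens.
- move=> a m A B p C D AB CD.
  apply: (coboundary_coJacobi (Ad2_std_r_flip uX) _ AB CD).
  by rewrite cybZ cyb_Ad2 ?scaler0 //; apply: cyb_std_r; apply: pchar_ext.
by move=> a b; rewrite /DJ_cobracket coboundary_lieb.
Qed.

Lemma bialgebra_DJ_cocycle Y : Y \in unitmx -> lie_bialgebra (DJ_cobracket Y) ->
  DJ_cocycle sigma Y.
Proof.
move=> uY lieY; split=> //.
have T0adj : adjmx sigma T0 = T0.
  rewrite /adjmx map_mulmap map_std_r_gal.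
  by rewrite mulmap_std_r // tr_diag_mx.
have S_adj : adjmx sigma (Ad Y T0) = Ad Y T0.
  suff : adjmx sigma (sqrtd *: Ad Y T0) = - (sqrtd *: Ad Y T0).
    by rewrite adjmx_scale gal_sqrtd scaleNr => /oppr_inj/(scalerI sqrtd_neq0).
  apply: lieb_su_inj => [a|].
    (* The adjoint of a sum of products AB with factors in su is the sum of the BA, which is the
       product map applied to the flipped tensor. *)
    have skew : adjmx sigma (mulmap (DJ_cobracket Y a)) = - mulmap (DJ_cobracket Y a).
      have [m [A [B E]]] := cobr_tens lieY a.
      rewrite -mulmapN -(cobr_skew lieY E) E !mulmap_sum adjmx_sum.
      apply: eq_bigr => i _; rewrite !mulmap_tens adjmxM !adjmx_su.
      by rewrite mulNmx mulmxN opprK.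
    move: skew; rewrite (mulmap_DJ_cobracket a uY) adjmx_lieb adjmx_su.
    by rewrite liebNl -liebC -liebNl.
  rewrite mxtrace_adjmx raddfN /= mxtraceZ mxtrace_Ad // rmorphM /= gal_sqrtd mulNr.
  by rewrite -mxtrace_adjmx T0adj.
pose M := adjmx sigma Y *m Y.
have uM : M \in unitmx by rewrite unitmx_mul adjmx_unit uY.
have dM : is_diag_mx M.
  (* Self-adjointness of Y [T0] Y^-1 says exactly that Y^* Y commutes with [T0]. *)
  apply: (comm_mulmap_std_r pchar_ext); rewrite /M.
  move: S_adj; rewrite /Ad !adjmxM T0adj adjmx_inv // => S_adj.
  rewrite -[in LHS](mulmxA _ Y) -[Y *m T0](mulmxKV uY) -S_adj !mulmxA.
  by rewrite mulmxV ?adjmx_unit // mul1mx.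
have fM : adjmx sigma M = M by rewrite adjmxM adjmxK.
have [e eE] : exists e : 'I_n -> F, forall i, M i i = (e i)%:A.
  suff ex i : exists e : F, M i i = e%:A by exact: (fin_all_exists ex).
  have : sigma (M i i) = M i i by rewrite -[in RHS]fM !mxE.
  by case/gal_fixed => e eE; exists e.
exists (diag_mx (\row_i e i)).
have ME : M = map_mx (in_alg K) (diag_mx (\row_i e i)).
  apply/matrixP=> i j; rewrite [RHS]mxE [diag_mx _ i j]mxE [(\row_ _ _) 0 i]mxE.
  have [<-|ij] := eqVneq i j.
    by rewrite eE mulr1n.
  by rewrite mulr0n rmorph0; apply/(is_diag_mxP dM).
by split=> //; rewrite -?(map_unitmx (in_alg K)) -?ME // diag_mx_is_diag.
Qed.
(** * Descent from the algebraic closure *)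

Section Descent.
Variables (L : fieldType) (iota : {rmorphism K -> L}) (h : 'I_n.-1 -> 'M[L]_n).
Hypothesis h_basis : orthonormal_cartan_basis h.

Local Notation "A ^i" := (map_mx iota A) (at level 2, format "A ^i").
Local Notation r0L := (std_r L n).

Lemma pchar_target : [pchar L] =i pred0.
Proof. by move=> p; rewrite (fmorph_pchar iota) pchar_ext. Qed.

Lemma map_DJ_cobracket X a :
  (DJ_cobracket X a)^i =
  coboundary (iota sqrtd *: Ad2 X^i r0L) (val a)^i.
Proof. by rewrite map_coboundary map_mxZ map_Ad2 map_std_r. Qed.

Lemma DJ_cobracket_given_by X : X \in unitmx ->
  DJ_given_by iota sqrtd h (DJ_cobracket X) X^i.
Proof.
move=> uX; split=> [c A B _ _|a]; first exact: coboundary_linear.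
rewrite map_DJ_cobracket coboundary_Ad2_r_DJ ?map_unitmx //.
exact: pchar_target.
Qed.

Lemma given_byE (delta : su sigma n -> 'M[K]_(n * n)) (X : 'M[L]_n) a : X \in unitmx ->
  DJ_given_by iota sqrtd h delta X ->
  (delta a)^i = coboundary (iota sqrtd *: Ad2 X r0L) (val a)^i.
Proof.
move=> uX [_ <-]; rewrite coboundary_Ad2_r_DJ //; exact: pchar_target.
Qed.

(* Applying the multiplication map to [delta] gives the inner derivation
   defined by [sqrt d Ad_X (T0)], which is therefore rational over [K] on a
   spanning set of matrices, hence so is [Ad_X (T0)]. *)
Lemma Ad_T0_rational (delta : su sigma n -> 'M[K]_(n * n)) (X : 'M[L]_n) : X \in unitmx ->
  DJ_given_by iota sqrtd h delta X ->
  exists T : 'M[K]_n, T^i = Ad X (mulmap r0L).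
Proof.
move=> uX dX; set S := Ad X _; pose S' := iota sqrtd *: S.
pose rational m (M : 'M[L]_m) := exists B : 'M[K]_m, M = B^i.
have rat0 m : rational m 0 by exists 0; rewrite map_mx0.
have ratD m M N : rational m M -> rational m N -> rational m (M + N).
  by move=> [B ->] [C ->]; exists (B + C); rewrite map_mxD.
have ratZ m c M : rational m M -> rational m (iota c *: M).
  by move=> [B ->]; exists (c *: B); rewrite map_mxZ.
have rat_su a : rational n (lieb S' (val a)^i).
  exists (mulmap (delta a)); rewrite map_mulmap (given_byE a uX dX).
  by rewrite mulmap_coboundary mulmapZ mulmap_Ad2.
have rat_mx A : rational n (lieb S' A^i).
  have [P [Q [c ->]]] := su_trace_decomp A.
  rewrite !map_mxD map_scalar_mx map_mxZ !liebDr [X in _ + X]liebC liebsl oppr0.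
  by rewrite addr0 liebZr; apply: ratD => //; apply: ratZ.
have rat_sum : rational n (n%:R *: S' - (\tr S')%:M).
  rewrite -sum_lieb_delta; apply: (big_ind (@rational n) (rat0 n) (@ratD n)) => i _.
  apply: (big_ind (@rational n) (rat0 n) (@ratD n)) => j _.
  have [B EB] := rat_mx (delta_mx i j); exists (B *m delta_mx j i).
  by rewrite map_mxM -EB !map_delta_mx.
have [B EB] := rat_sum.
(* Conjugation preserves the trace, so the scalar to be added back is already known to lie in K. *)
have trS : (\tr S')%:M = ((sqrtd * \tr T0)%:M : 'M_n)^i.
  rewrite map_scalar_mx /S' mxtraceZ /S mxtrace_Ad // -(map_std_r iota) -map_mulmap.
  by rewrite trace_map_mx rmorphM.
exists ((n%:R * sqrtd)^-1 *: (B + (sqrtd * \tr T0)%:M)).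
rewrite map_mxZ map_mxD -EB trS subrK /S' scalerA -(rmorph_nat iota) -rmorphM.
rewrite scalerA -rmorphM -mulrA mulVf ?rmorph1 ?scale1r //.
by rewrite mulf_neq0 ?sqrtd_neq0 // natK -lt0n.
Qed.

(** The eigenvalues of [T] lie in K, so eigenvectors over K exist, and they form the columns of [Y].
    Then X^-1 Y commutes with the diagonal matrix [TL], hence is diagonal. *)
Lemma Ad_T0_split (X : 'M[L]_n) (T : 'M[K]_n) : X \in unitmx ->
  T^i = Ad X (mulmap r0L) ->
  exists2 Y : 'M[K]_n, Y \in unitmx & is_diag_mx (invmx X *m Y^i).
Proof.
move=> uX TX; set TL := mulmap r0L in TX.
pose w (i : 'I_n) : K := 2%:R^-1 + (n - i.+1)%:R.
have TLE : TL = diag_mx (\row_i iota (w i)).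
  rewrite /TL mulmap_std_r; congr diag_mx; apply/rowP=> i; rewrite !mxE.
  by rewrite rmorphD fmorphV !rmorph_nat.
have TXX : T^i *m X = X *m TL by rewrite TX /Ad mulmxKV.
have eigen i : exists y : 'cV[K]_n, y != 0 /\ T *m y = w i *: y.
  have : \det (T - (w i)%:M)^T == 0.
    rewrite -(fmorph_eq0 iota) -det_map_mx -map_trmx map_mxB map_scalar_mx.
    (* Over L, column i of [X] is an eigenvector. [det0P] provides row vectors, whence the
       transposes. *)
    apply/det0P; exists (X *m delta_mx i (0 : 'I_1))^T.
      apply: contraTneq isT => /(congr1 trmx); rewrite trmxK trmx0.
      move/(congr1 (mulmx (invmx X))); rewrite mulKmx // mulmx0.
      by move/matrixP/(_ i 0)/eqP; rewrite !mxE !eqxx oner_eq0.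
    rewrite -trmx_mul mulmxBl mulmxA TXX mul_scalar_mx -mulmxA TLE.
    rewrite [X in trmx X](_ : _ = 0) ?trmx0 //; apply/eqP; rewrite subr_eq0; apply/eqP.
    rewrite scalemxAr; congr mulmx; apply/matrixP=> k l.
    rewrite mul_diag_mx !mxE; case: eqVneq => [->//|_]; by rewrite !mulr0.
  move=> /det0P[v v0 Tv]; exists v^T; split.
    by apply: contra_neq v0 => /(congr1 trmx); rewrite trmxK trmx0.
  move/(congr1 trmx): Tv; rewrite trmx_mul trmxK trmx0 mulmxBl mul_scalar_mx.
  by move/eqP; rewrite subr_eq0 => /eqP.
have [y yE] := fin_all_exists eigen.
pose Y : 'M[K]_n := \matrix_(k, i) y i k 0.
have colY i : col i Y = y i by apply/colP=> k; rewrite !mxE.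
have TY : T *m Y = Y *m diag_mx (\row_i w i).
  apply/matrixP=> k i; rewrite mul_mx_diag.
  have /matrixP/(_ k 0) := (yE i).2; rewrite !mxE => E.
  rewrite mulrC -E; apply: eq_bigr => j _; by rewrite !mxE.
set D := invmx X *m Y^i.
have YXD : Y^i = X *m D by rewrite /D mulKVmx.
have dD : is_diag_mx D.
  apply: (comm_mulmap_std_r pchar_target); rewrite -/TL.
  apply: (can_inj (mulKmx uX)); rewrite (mulmxA X D) -YXD (mulmxA X TL) -TXX -mulmxA -YXD.
  rewrite -map_mxM TY map_mxM map_diag_mx TLE; congr (_ *m diag_mx _).
  by apply/rowP => i; rewrite !mxE.
exists Y => //; rewrite -(map_unitmx iota) YXD unitmx_mul uX /=.
have [e De] := diag_mxP _ dD.
(* A zero diagonal entry of [D] would make the eigenvector [y i] zero. *)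
rewrite unitmxE unitfE De det_diag; apply/prodf_neq0 => i _.
apply: contra_neq (yE i).1 => ei.
apply/colP => k; apply: (fmorph_inj iota); rewrite -colY.
have /matrixP/(_ k i) := YXD; rewrite De mul_mx_diag !mxE => ->.
by rewrite ei mulr0 rmorph0.
Qed.

(** Over L the matrices [X] and [Y] differ by a diagonal factor, which stabilizes the r-matrix. The
    cobrackets therefore agree after the injective base change, hence over K. *)
Lemma quadratic_DJP delta :
  quadratic_DJ iota sqrtd h delta <->
  exists2 Y, DJ_cocycle sigma Y & delta = DJ_cobracket Y.
Proof.
split=> [[bd [X [uX dX]]]|[Y cY ->]]; last first.
  split; first exact: DJ_cobracket_bialgebra.
  have [uY _] := cY; exists Y^i; split; first by rewrite map_unitmx.
  exact: DJ_cobracket_given_by.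
have [T TX] := Ad_T0_rational uX dX.
have [Y uY dD] := Ad_T0_split uX TX.
have E : delta = DJ_cobracket Y.
  apply/funext => a; apply: (@map_mx_inj _ _ iota).
  rewrite map_DJ_cobracket (given_byE a uX dX).
  have uYi : Y^i \in unitmx by rewrite map_unitmx.
  have uD : invmx X *m Y^i \in unitmx by rewrite unitmx_mul unitmx_inv uX.
  by rewrite -[in RHS](mulKVmx uX Y^i) (Ad2M _ uX uD) (Ad2_diag_std_r uD dD).
by exists Y => //; apply: bialgebra_DJ_cocycle; rewrite -?E.
Qed.

Lemma gauge_equiv_DJ_cobracket X Y : X \in unitmx -> Y \in unitmx ->
  gauge_equiv (DJ_cobracket X) (DJ_cobracket Y) <-> cohomologous sigma X Y.
Proof.
move=> uX uY; split=> [[Q [uQ E]]|[Q [D [uQ dD uD YE]]]].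
  have [Qu _] := uQ; have uQX : Q *m X \in unitmx by rewrite unitmx_mul Qu.
  exists Q, (invmx (Q *m X) *m Y); split=> //; last by rewrite mulKVmx.
    by apply: (DJ_cobracket_inj uQX uY); rewrite E (DJ_cobracket_gauge uQ uX).
  by rewrite unitmx_mul unitmx_inv uQX.
have [Qu _] := uQ; have uQX : Q *m X \in unitmx by rewrite unitmx_mul Qu.
by exists Q, uQ; rewrite (DJ_cobracket_gauge uQ uX) YE (DJ_cobracket_mul_diag uQX).
Qed.

End Descent.

End UnitaryBialgebras.

(** * The bijection between classes *)

Theorem proposition3p4
  (F : fieldType) (char0 : [pchar F] =i pred0)
  (d : F) (d_neq0 : d != 0) (d_nonsquare : ~ exists x : F, x ^+ 2 = d)
  (K : splittingFieldType F) (sqrtd : K) (sqrtd2 : sqrtd ^+ 2 = d%:A)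
  (K_gen : <<1; sqrtd>>%VS = {:K}%VS)
  (sigma : gal_of {:K}) (sigma_gal : sigma \in ('Gal({:K} / 1))%g)
  (sigma_nontriv : sigma != 1%g)
  (Fbar : closedFieldType) (iota : {rmorphism K -> Fbar})
  (Fbar_alg : forall x : Fbar, algebraicOver (fun a : F => iota a%:A) x)
  (n : nat) (n_gt0 : (0 < n)%N)
  (h : 'I_n.-1 -> 'M[Fbar]_n) (h_basis : orthonormal_cartan_basis h) :
  exists f : set 'M[K]_n -> set (su sigma n -> 'M[K]_(n * n)%N),
    set_bij (H1_DJ sigma n) (quadratic_DJ_classes sigma iota sqrtd h) f /\
    (forall X : 'M[K]_n, DJ_cocycle sigma X ->
       exists2 delta, f (H1_class sigma X) delta
         & DJ_given_by iota sqrtd h delta (map_mx iota X)).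
Proof.
pose cobr (X : 'M[K]_n) : su sigma n -> 'M[K]_(n * n)%N := DJ_cobracket sqrtd X.
have quadP delta : quadratic_DJ iota sqrtd h delta <->
    exists2 Y, DJ_cocycle sigma Y & delta = cobr Y.
  exact: (quadratic_DJP char0 d_neq0 sqrtd2 K_gen sigma_nontriv n_gt0 iota h_basis).
have cohP X Y : DJ_cocycle sigma X -> DJ_cocycle sigma Y ->
    gauge_equiv (cobr X) (cobr Y) <-> cohomologous sigma X Y.
  move=> [uX _] [uY _].
  exact: (gauge_equiv_DJ_cobracket char0 d_neq0 sqrtd2 K_gen sigma_nontriv n_gt0).
pose quad_class delta :=
  eq_class (quadratic_DJ iota sqrtd h) (gauge_equiv (sigma := sigma) (n := n)) delta.
have imE X : DJ_cocycle sigma X ->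
    (cobr @` H1_class sigma X)%classic = quad_class (cobr X).
  move=> cX; apply/seteqP; split=> delta /=.
    by move=> [Y [cY XY] <-]; split; [apply/quadP; exists Y | apply/cohP].
  by move=> [/quadP[Y cY ->] XY]; exists Y => //; split=> //; apply/cohP.
(* A cohomology class is recovered from its image under [cobr]; this gives injectivity. *)
have classE X : DJ_cocycle sigma X -> H1_class sigma X =
    [set Z | DJ_cocycle sigma Z /\ (cobr @` H1_class sigma X)%classic (cobr Z)]%classic.
  move=> cX; apply/seteqP; split=> Z.
    by move=> XZ; split; [case: XZ | exists Z].
  by move=> [cZ]; rewrite imE // => -[_ XZ]; split=> //; apply/cohP.
exists (fun C => cobr @` C)%classic; split; first split.
- move=> _ [X cX <-]; exists (cobr X); first by apply/quadP; exists X.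
  exact: esym (imE X cX).
- move=> _ _ /set_mem[X cX <-] /set_mem[Y cY <-] E.
  rewrite -/(H1_class sigma X) -/(H1_class sigma Y) in E *.
  by rewrite classE // E -classE.
- move=> _ [delta /quadP[Y cY ->] <-]; exists (H1_class sigma Y); first by exists Y.
  exact: imE.
move=> X cX; exists (cobr X).
  (* [X] lies in its own class, with both factors equal to 1. *)
  exists X => //; split=> //; exists 1%:M, 1%:M; split.
  - by split; [exact: unitmx1 | rewrite adjmx1 mulmx1].
  - exact: scalar_mx_is_diag.
  - exact: unitmx1.
  - by rewrite mul1mx mulmx1.
have [uX _] := cX.
exact: (DJ_cobracket_given_by sqrtd sigma char0 n_gt0 iota h_basis uX).
Qed.
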